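(* Let $u\colon R\to U$ be an epimorphism of associative rings such that the flat dimension of the right $R$-module $U$ does not exceed $1$. Then: (a) the full subcategory $R\text{-mod}_{u\text{-co}}$ of left $u$-comodules is closed under kernels, cokernels, extensions, and direct sums in the category $R\text{-mod}$ of left $R$-modules; so $R\text{-mod}_{u\text{-co}}$ is an abelian category and the embedding functor $R\text{-mod}_{u\text{-co}}\to R\text{-mod}$ is exact; (b) assuming also that $\operatorname{Tor}^R_1(U,U)=0$, the functor $\Gamma_u\colon R\text{-mod}\to R\text{-mod}_{u\text{-co}}$ is right adjoint to the fully faithful embedding functor $R\text{-mod}_{u\text{-co}}\to R\text{-mod}$.
   Context: Rings are associative and unital, not necessarily commutative. A ring homomorphism $u\colon R\to U$ is a ring epimorphism iff the multiplication map $U\otimes_R U\to U$ is an isomorphism; it is not assumed injective. A left $R$-module $M$ is a (left) $u$-comodule if $U\otimes_R M=0=\operatorname{Tor}^R_1(U,M)$. $K^\bullet$ denotes the two-term complex of $R$-$R$-bimodules $R\xrightarrow{u}U$ with $R$ in cohomological degree $-1$ and $U$ in cohomological degree $0$. For a left $R$-module $A$, $\Gamma_u(A)=\operatorname{Tor}_1^R(K^\bullet,A)=H^{-1}(K^\bullet\otimes_R^{\mathbb L}A)$, with the left $R$-module structure induced by the left action of $R$ on $K^\bullet$. *)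

(* Defs.v *)
From HB Require Import structures.
From mathcomp Require Import all_boot all_algebra.
From mathcomp Require Import boolp classical_sets functions cardinality fsbigop.

Set Implicit Arguments.
Unset Strict Implicit.
Unset Printing Implicit Defensive.

Import GRing.Theory.
Local Open Scope classical_set_scope.
Local Open Scope ring_scope.

Section LinearMaps.
Variable R : pzRingType.
Implicit Types M N P : lmodType R.

Definition mklin M N (f : M -> N) (fl : linear f) : {linear M -> N} :=
  HB.pack f (GRing.isLinear.Build R M N *:%R f fl).

Lemma lin_ext M N (f g : {linear M -> N}) : f =1 g -> f = g.
Proof.
case: f g => [f [[fa] [fs]]] [g [[ga] [gs]]] /= /funext efg.
subst g; congr GRing.Linear.Pack; congr GRing.Linear.Class.
- by congr GRing.isNmodMorphism.Axioms_; apply: Prop_irrelevance.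
- by congr GRing.isScalable.Axioms_; apply: Prop_irrelevance.
Qed.

Fact lin_id_linear M : linear (fun x : M => x).
Proof. by []. Qed.
Definition lin_id M : {linear M -> M} := mklin (@lin_id_linear M).

Fact lin_comp_linear M N P (g : {linear N -> P}) (f : {linear M -> N}) :
  linear (fun x => g (f x)).
Proof. by move=> a x y; rewrite !linearP. Qed.
Definition lin_comp M N P (g : {linear N -> P}) (f : {linear M -> N}) :
  {linear M -> P} := mklin (lin_comp_linear g f).

Lemma lin_compE M N P (g : {linear N -> P}) (f : {linear M -> N}) x :
  lin_comp g f x = g (f x).
Proof. by []. Qed.

Fact lin_add_linear M N (f g : {linear M -> N}) : linear (fun x => f x + g x).
Proof. by move=> a x y; rewrite !linearP scalerDr addrACA. Qed.
Definition lin_add M N (f g : {linear M -> N}) := mklin (lin_add_linear f g).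

Lemma lin_addE M N (f g : {linear M -> N}) x : lin_add f g x = f x + g x.
Proof. by []. Qed.

Fact lin_opp_linear M N (f : {linear M -> N}) : linear (fun x => - f x).
Proof. by move=> a x y; rewrite linearP opprD scalerN. Qed.
Definition lin_opp M N (f : {linear M -> N}) := mklin (lin_opp_linear f).

Fact lin_zero_linear M N : linear (fun _ : M => 0 : N).
Proof. by move=> a x y; rewrite scaler0 addr0. Qed.
Definition lin_zero M N := mklin (@lin_zero_linear M N).

End LinearMaps.

(* The abelian group Hom_R(M, N). *)
Section LinearMapsZmodule.
Variables (R : pzRingType) (M N : lmodType R).

Fact lin_addA : associative (@lin_add R M N).
Proof. by move=> f g h; apply: lin_ext => x /=; rewrite addrA. Qed.
Fact lin_addC : commutative (@lin_add R M N).
Proof. by move=> f g; apply: lin_ext => x /=; rewrite addrC. Qed.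
Fact lin_add0 : left_id (lin_zero M N) (@lin_add R M N).
Proof. by move=> f; apply: lin_ext => x /=; rewrite add0r. Qed.
Fact lin_addN : left_inverse (lin_zero M N) (@lin_opp R M N) (@lin_add R M N).
Proof. by move=> f; apply: lin_ext => x /=; rewrite addNr. Qed.

HB.instance Definition _ := gen_eqMixin {linear M -> N}.
HB.instance Definition _ := gen_choiceMixin {linear M -> N}.
HB.instance Definition _ :=
  GRing.isZmodule.Build {linear M -> N} lin_addA lin_addC lin_add0 lin_addN.

End LinearMapsZmodule.

Section Kernel.
Variables (R : pzRingType) (M N : lmodType R) (f : {linear M -> N}).

Definition in_ker : {pred M} := fun x => f x == 0.

Fact in_ker_submod : subsemimod_closed in_ker.
Proof.
split; first split; rewrite ?unfold_in /=.
- by rewrite /in_ker linear0.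
- by move=> x y; rewrite !unfold_in /in_ker linearD => /eqP-> /eqP->; rewrite addr0.
- by move=> a x; rewrite !unfold_in /in_ker linearZ => /eqP-> /=; rewrite scaler0.
Qed.
HB.instance Definition _ := GRing.isSubmodClosed.Build R M in_ker in_ker_submod.

Record kermod : Type := Kermod { kval :> M; kvalP : kval \in in_ker }.
HB.instance Definition _ := [isSub of kermod for kval].
HB.instance Definition _ := [Choice of kermod by <:].
HB.instance Definition _ := [SubChoice_isSubLmodule of kermod by <:].

Fact kval_linear : linear kval.
Proof. by []. Qed.
Definition kincl : {linear kermod -> M} := mklin kval_linear.

End Kernel.

Section KernelMap.
Variables (R : pzRingType) (M N M' N' : lmodType R).
Variables (f : {linear M -> N}) (f' : {linear M' -> N'}).
Variables (g : {linear M -> M'}) (h : {linear N -> N'}).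
Hypothesis gh : forall x, f' (g x) = h (f x).

Fact kermap_subproof (x : kermod f) : g (kval x) \in in_ker f'.
Proof. by rewrite unfold_in /in_ker gh (eqP (kvalP x)) linear0. Qed.

Fact kermap_linear : linear (fun x : kermod f => Kermod (kermap_subproof x)).
Proof. by move=> a x y; apply: val_inj; rewrite /= linearP. Qed.

Definition kermap : {linear kermod f -> kermod f'} := mklin kermap_linear.
End KernelMap.

(* lquot S is V modulo the R-submodule generated by S. *)
Section Quotient.
Variables (R : pzRingType) (V : lmodType R) (S : set V).

Inductive span : V -> Prop :=
| span_zero : span 0
| span_mem x of S x : span x
| span_add x y of span x & span y : span (x + y)
| span_scale a x of span x : span (a *: x).

Definition in_span : {pred V} := fun x => `[< span x >].

Fact in_span_submod : subsemimod_closed in_span.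
Proof.
split; first split.
- exact/asboolP/span_zero.
- by move=> x y /asboolP Sx /asboolP Sy; apply/asboolP/span_add.
- by move=> a x /asboolP Sx; apply/asboolP/span_scale.
Qed.
HB.instance Definition _ := GRing.isSubmodClosed.Build R V in_span in_span_submod.

Definition lquot : Type := Quotient.quot in_span.
HB.instance Definition _ := GRing.Zmodule.on lquot.

Definition qproj (x : V) : lquot := (\pi_(Quotient.quot in_span) x)%qT.
Definition qrepr (x : lquot) : V := generic_quotient.repr x.

Lemma qreprK x : qproj (qrepr x) = x.
Proof. exact: generic_quotient.reprK. Qed.

Lemma qproj_eq x y : qproj x = qproj y <-> span (x - y).
Proof.
split=> [/eqP|xy]; first by rewrite -Quotient.idealrBE => /asboolP.
by apply/eqP; rewrite -Quotient.idealrBE; apply/asboolP.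
Qed.

Lemma qprojB x y : qproj (x - y) = qproj x - qproj y.
Proof. exact: raddfB. Qed.
Lemma qprojD x y : qproj (x + y) = qproj x + qproj y.
Proof. exact: raddfD. Qed.

Definition qscale (a : R) (x : lquot) : lquot := qproj (a *: qrepr x).

Lemma qscaleE a x : qscale a (qproj x) = qproj (a *: x).
Proof.
apply/qproj_eq; rewrite -scalerBr; apply: span_scale.
by apply/qproj_eq; rewrite qreprK.
Qed.

Fact qscaleA a b x : qscale a (qscale b x) = qscale (a * b) x.
Proof. by rewrite -[x]qreprK !qscaleE scalerA. Qed.
Fact qscale1 : left_id 1 qscale.
Proof. by move=> x; rewrite -[x]qreprK !qscaleE scale1r. Qed.
Fact qscaleDr : right_distributive qscale +%R.
Proof.
by move=> a x y; rewrite -[x]qreprK -[y]qreprK -qprojD !qscaleE scalerDr qprojD.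
Qed.
Fact qscaleDl x : {morph qscale^~ x : a b / a + b}.
Proof. by move=> a b; rewrite -[x]qreprK !qscaleE scalerDl qprojD. Qed.
HB.instance Definition _ := GRing.Zmodule_isLmodule.Build R lquot
  qscaleA qscale1 qscaleDr qscaleDl.

Fact qproj_linear : linear qproj.
Proof. by move=> a x y; rewrite qprojD -qscaleE. Qed.
HB.instance Definition _ := GRing.isLinear.Build R V lquot _ qproj qproj_linear.

Section Lift.
Variables (W : lmodType R) (h : {linear V -> W}).
Hypothesis hS : forall x, S x -> h x = 0.

Fact span_lift x : span x -> h x = 0.
Proof.
elim=> {x} [|x /hS //|x y _ hx _ hy|a x _ hx].
- exact: linear0.
- by rewrite linearD hx hy addr0.
- by rewrite linearZ /= hx scaler0.
Qed.

Fact qlift_eq x : h (qrepr (qproj x)) = h x.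
Proof.
apply/eqP; rewrite -subr_eq0 -linearB; apply/eqP/span_lift.
by apply/qproj_eq; rewrite qreprK.
Qed.

Fact qlift_linear : linear (fun x : lquot => h (qrepr x)).
Proof.
move=> a x y; rewrite -[x]qreprK -[y]qreprK -linearP /=.
by rewrite !qlift_eq linearP.
Qed.
Definition qlift : {linear lquot -> W} := mklin qlift_linear.

Lemma qliftE x : qlift (qproj x) = h x.
Proof. exact: qlift_eq. Qed.
End Lift.

End Quotient.
Arguments qlift : simpl never.

(* freemod R X is the free R-module on X: functions X -> R of finite support. *)
Section Free.
Variables (R : pzRingType) (X : choiceType).

Definition fin_supp : {pred X -> R^o} :=
  fun f => `[< finite_set [set x | f x != 0] >].

Fact fin_supp_submod : subsemimod_closed fin_supp.
Proof.
split; first split.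
- apply/asboolP; rewrite (_ : [set _ | _] = set0) //.
  by apply/seteqP; split=> x //=; rewrite eqxx.
- move=> f g /asboolP ff /asboolP fg; apply/asboolP.
  apply: (@sub_finite_set _ _ ([set x | f x != 0] `|` [set x | g x != 0])).
    move=> x /=; case: (eqVneq (f x) 0) => [fx0|]; last by left.
    by case: (eqVneq (g x) 0) => [gx0|]; [rewrite addrfctE fx0 gx0 addr0 eqxx | right].
  by rewrite finite_setU.
- move=> a f /asboolP ff; apply/asboolP; apply: sub_finite_set ff => x /=.
  by apply: contraNneq => fx0; rewrite scalrfctE fx0 scaler0.
Qed.
HB.instance Definition _ := GRing.isSubmodClosed.Build R (X -> R^o) fin_supp
  fin_supp_submod.

Record freemod : Type := Freemod { fval :> X -> R^o; fvalP : fval \in fin_supp }.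
HB.instance Definition _ := [isSub of freemod for fval].
HB.instance Definition _ := [Choice of freemod by <:].
HB.instance Definition _ := [SubChoice_isSubLmodule of freemod by <:].

Fact fbase_subproof (x : X) : (fun y => (y == x)%:R : R^o) \in fin_supp.
Proof.
apply/asboolP; apply: (@sub_finite_set _ _ [set x]) => // y /=.
by case: (eqVneq y x) => // _; rewrite eqxx.
Qed.
Definition fbase (x : X) : freemod := Freemod (fbase_subproof x).

Lemma freemod_supp (p : freemod) :
  exists2 r : seq X, uniq r & forall x, p x != 0 -> x \in r.
Proof.
have /asboolP fp := fvalP p.
exists (finmap.enum_fset (fset_set [set x | fval p x != 0])).
  exact: finmap.fset_uniq.
by move=> x px; have := in_fset_set fp x; rewrite mem_set.
Qed.

Section Lift.
Variables (M : lmodType R) (g : X -> M).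

Definition fsum (p : freemod) : M := \sum_(x \in [set: X]) (p x : R) *: g x.

Lemma fsumE (r : seq X) (p : freemod) : uniq r ->
  (forall x, p x != 0 -> x \in r) -> fsum p = \sum_(x <- r) (p x : R) *: g x.
Proof.
move=> Ur pr; rewrite /fsum (fsbigE r) //; last first.
  move=> x _ xr; have /eqP -> : p x == 0 by apply: contraNT xr; exact: pr.
  by rewrite scale0r.
by apply: eq_bigl => x; rewrite in_setT.
Qed.

Fact fsum_linear : linear fsum.
Proof.
move=> a p q; have [r _ pr] := freemod_supp p; have [s _ qs] := freemod_supp q.
have Ut := undup_uniq (r ++ s).
rewrite !(fsumE Ut) ?scaler_sumr -?big_split /=.
- by apply: eq_bigr => x _; rewrite scalerDl scalerA.
- by move=> x /qs; rewrite mem_undup mem_cat orbC => ->.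
- by move=> x /pr; rewrite mem_undup mem_cat => ->.
move=> x; apply: contraNT; rewrite mem_undup mem_cat negb_or => /andP[xr xs].
have /eqP px : p x == 0 by apply: contraNT xr; exact: pr.
have /eqP qx : q x == 0 by apply: contraNT xs; exact: qs.
by change (a *: p x + q x == 0); rewrite px qx scaler0 addr0.
Qed.
Definition flift : {linear freemod -> M} := mklin fsum_linear.

Lemma fliftE x : flift (fbase x) = g x.
Proof.
rewrite /flift /= (@fsumE [:: x]) ?big_seq1 //= ?eqxx ?scale1r //.
by move=> y; rewrite inE; case: (eqVneq y x) => // _; rewrite eqxx.
Qed.
End Lift.

Lemma free_ext (M : lmodType R) (f g : {linear freemod -> M}) :
  (forall x, f (fbase x) = g (fbase x)) -> f =1 g.
Proof.
move=> fg p; have [r Ur pr] := freemod_supp p.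
have -> : p = \sum_(x <- r) (p x : R) *: fbase x.
  apply/val_inj/funext => y.
  have evl : linear (fun q : freemod => q y : R^o) by [].
  rewrite -[RHS]/(mklin evl _) linear_sum /=.
  rewrite (eq_bigr (fun x => (p x : R) *: ((y == x)%:R : R^o))) //.
  have [yr|yr] := boolP (y \in r).
    rewrite (bigD1_seq y) //= eqxx big1 ?addr0 => [|x xy].
      by rewrite /GRing.scale /= mulr1.
    by rewrite eq_sym (negPf xy) scaler0.
  rewrite big_seq big1 => [|x xr]; last first.
    by case: eqVneq => [yx|]; [rewrite yx xr in yr | rewrite scaler0].
  by apply/eqP; apply: contraNT yr; exact: pr.
by rewrite !linear_sum; apply: eq_bigr => x _; rewrite !linearZ /= fg.
Qed.

End Free.
Arguments fbase {R X} x.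
Arguments flift : simpl never.

(* Right R-modules are left modules over the converse ring R^c, so the right
   action n r is written (r : R^c) *: n.  The tensor product is the free
   abelian group on N x M modulo the usual relations; as an abelian group it is
   an lmodType over int. *)
Section Tensor.
Variable R : pzRingType.

Inductive tens_rel (N : lmodType R^c) (M : lmodType R) :
    set (freemod int (N * M)%type) :=
| tens_relDl n n' m : tens_rel (fbase (n + n', m) - fbase (n, m) - fbase (n', m))
| tens_relDr n m m' : tens_rel (fbase (n, m + m') - fbase (n, m) - fbase (n, m'))
| tens_relZ n (r : R) m : tens_rel (fbase ((r : R^c) *: n, m) - fbase (n, r *: m)).

Definition tensor (N : lmodType R^c) (M : lmodType R) : lmodType int :=
  lquot (@tens_rel N M).

Definition pure (N : lmodType R^c) (M : lmodType R) (n : N) (m : M) : tensor N M :=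
  qproj (@tens_rel N M) (fbase (n, m)).

Lemma pureDl (N : lmodType R^c) (M : lmodType R) (n n' : N) (m : M) : pure (n + n') m = pure n m + pure n' m.
Proof.
rewrite /pure -qprojD; apply/qproj_eq; rewrite opprD addrA.
exact/span_mem/tens_relDl.
Qed.

Lemma pureDr (N : lmodType R^c) (M : lmodType R) (n : N) (m m' : M) : pure n (m + m') = pure n m + pure n m'.
Proof.
rewrite /pure -qprojD; apply/qproj_eq; rewrite opprD addrA.
exact/span_mem/tens_relDr.
Qed.

Lemma pureZ (N : lmodType R^c) (M : lmodType R) (n : N) (r : R) (m : M) :
  pure ((r : R^c) *: n) m = pure n (r *: m).
Proof. by apply/qproj_eq/span_mem/tens_relZ. Qed.

Lemma tensor_ext (N : lmodType R^c) (M : lmodType R) (G : lmodType int) (f g : {linear tensor N M -> G}) :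
  (forall n m, f (pure n m) = g (pure n m)) -> f =1 g.
Proof.
move=> fg x; rewrite -[x]qreprK; move: (qrepr x).
apply: (free_ext (f := lin_comp f (qproj (@tens_rel N M)))
  (g := lin_comp g (qproj (@tens_rel N M)))) => -[n m].
exact: fg.
Qed.

Section Map.
Variables (N N' : lmodType R^c) (M M' : lmodType R).
Variables (f : {linear N -> N'}) (g : {linear M -> M'}).

Let h := flift (fun p : N * M => pure (f p.1) (g p.2)).

Fact tens_map_subproof x : tens_rel x -> h x = 0.
Proof.
case=> {x} [n n' m|n m m'|n r m]; rewrite !linearB /h !fliftE /= !linearE.
- by rewrite pureDl -addrA -opprD subrr.
- by rewrite pureDr -addrA -opprD subrr.
- by rewrite pureZ subrr.
Qed.
Definition tens_map : {linear tensor N M -> tensor N' M'} :=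
  qlift tens_map_subproof.

Lemma tens_mapE n m : tens_map (pure n m) = pure (f n) (g m).
Proof. by rewrite /tens_map /pure qliftE /h fliftE. Qed.
End Map.
#[local] Arguments tens_map : simpl never.

Definition is_flat (N : lmodType R^c) : Prop :=
  forall (M M' : lmodType R) (g : {linear M -> M'}),
    injective g -> injective (tens_map (lin_id N) g).

(* There is a flat resolution 0 -> F1 -> F0 -> N -> 0. *)
Definition flat_dim_le1 (N : lmodType R^c) : Prop :=
  exists (F1 F0 : lmodType R^c) (i : {linear F1 -> F0}) (p : {linear F0 -> N}),
    [/\ is_flat F1, is_flat F0, injective i, (forall y, exists x, p x = y)
      & forall x, p x = 0 <-> exists y, i y = x].

End Tensor.
Arguments tens_map : simpl never.

Section Bimodules.
Variable R : pzRingType.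

(* An R-R-bimodule: a right R-module with a left R-action by endomorphisms of
   the right module. *)
Record bimod : Type := Bimod {
  bcarrier :> lmodType R^c;
  lact : R -> {linear bcarrier -> bcarrier};
  lactA : forall r s x, lact r (lact s x) = lact (r * s) x;
  lact1 : forall x, lact 1 x = x;
  lactD : forall r s x, lact (r + s) x = lact r x + lact s x }.

Record bimod_hom (B C : bimod) : Type := BimodHom {
  bfun :> {linear B -> C};
  bfun_lact : forall r x, bfun (lact B r x) = lact C r (bfun x) }.

Definition bimod_id (B : bimod) : bimod_hom B B :=
  @BimodHom B B (lin_id B) (fun _ _ => erefl).

(* The tensor product of a bimodule and a left R-module, as a left R-module:
   r (b (x) m) = (r b) (x) m. *)
Definition btensor (B : bimod) (M : lmodType R) : Type := tensor B M.
HB.instance Definition _ B M := GRing.Zmodule.copy (btensor B M) (tensor B M).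

Section Scale.
Variables (B : bimod) (M : lmodType R).

Definition bscale (r : R) : btensor B M -> btensor B M :=
  tens_map (lact B r) (lin_id M).

Fact bscaleA r s x : bscale r (bscale s x) = bscale (r * s) x.
Proof.
apply: (tensor_ext (f := lin_comp (tens_map (lact B r) (lin_id M))
  (tens_map (lact B s) (lin_id M))) (g := tens_map (lact B (r * s)) (lin_id M)))
  => n m.
by rewrite lin_compE !tens_mapE /= lactA.
Qed.
Fact bscale1 : left_id 1 bscale.
Proof.
move=> x; apply: (tensor_ext (g := lin_id _)) => n m.
by rewrite tens_mapE /= lact1.
Qed.
Fact bscaleDr : right_distributive bscale +%R.
Proof. by move=> r x y; apply: linearD. Qed.
Fact bscaleDl x : {morph bscale^~ x : r s / r + s}.
Proof.
move=> r s; apply: (tensor_ext (g := lin_add (tens_map (lact B r) (lin_id M))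
  (tens_map (lact B s) (lin_id M)))) => n m.
by rewrite lin_addE !tens_mapE /= lactD pureDl.
Qed.
HB.instance Definition _ := GRing.Zmodule_isLmodule.Build R (btensor B M)
  bscaleA bscale1 bscaleDr bscaleDl.
End Scale.

Section Map.
Variables (B C : bimod) (M M' : lmodType R).
Variables (f : bimod_hom B C) (g : {linear M -> M'}).

Fact btens_map_linear : linear (tens_map f g : btensor B M -> btensor C M').
Proof.
move=> r x y; rewrite [LHS]linearD; congr (_ + _).
apply: (tensor_ext (f := lin_comp (tens_map f g) (tens_map (lact B r) (lin_id M)))
  (g := lin_comp (tens_map (lact C r) (lin_id M')) (tens_map f g))) => n m.
by rewrite !lin_compE !tens_mapE /= bfun_lact.
Qed.
Definition btens_map : {linear btensor B M -> btensor C M'} :=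
  mklin btens_map_linear.
End Map.

Lemma btens_mapE (B C : bimod) (M M' : lmodType R) (f : bimod_hom B C) (g : {linear M -> M'}) n m :
  btens_map f g (pure n m : btensor B M) = pure (f n) (g m).
Proof. exact: tens_mapE. Qed.

Lemma btens_map_1 (B : bimod) (M : lmodType R)
    (f : bimod_hom B B) (g : {linear M -> M}) x :
  (forall n, f n = n) -> (forall m, g m = m) -> btens_map f g x = x.
Proof.
move=> fE gE; apply: (tensor_ext (g := lin_id (tensor B M))) => n m.
by rewrite tens_mapE fE gE.
Qed.

Lemma btens_map_comp (B C D : bimod) (M N P : lmodType R)
    (f : bimod_hom B C) (f' : bimod_hom C D) (f'' : bimod_hom B D)
    (g : {linear M -> N}) (g' : {linear N -> P}) (g'' : {linear M -> P}) x :
  (forall n, f' (f n) = f'' n) -> (forall m, g' (g m) = g'' m) ->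
  btens_map f' g' (btens_map f g x) = btens_map f'' g'' x.
Proof.
move=> fE gE.
apply: (tensor_ext (f := lin_comp (tens_map f' g') (tens_map f g))) => n m.
by rewrite lin_compE !tens_mapE fE gE.
Qed.

Lemma btens_map_sq (B C C' D : bimod) (M N N' P : lmodType R)
    (f : bimod_hom B C) (f' : bimod_hom C D)
    (h : bimod_hom B C') (h' : bimod_hom C' D)
    (g : {linear M -> N}) (g' : {linear N -> P})
    (k : {linear M -> N'}) (k' : {linear N' -> P}) x :
  (forall n, f' (f n) = h' (h n)) -> (forall m, g' (g m) = k' (k m)) ->
  btens_map f' g' (btens_map f g x) = btens_map h' k' (btens_map h k x).
Proof.
move=> fE gE.
apply: (tensor_ext (f := lin_comp (tens_map f' g') (tens_map f g))
  (g := lin_comp (tens_map h' k') (tens_map h k))) => n m.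
by rewrite !lin_compE !tens_mapE fE gE.
Qed.

End Bimodules.
Arguments btens_map : simpl never.

Lemma pairP1 (R : pzRingType) (M N : lmodType R) a (x y : M * N) :
  (a *: x + y).1 = a *: x.1 + y.1.
Proof. by []. Qed.
Lemma pairP2 (R : pzRingType) (M N : lmodType R) a (x y : M * N) :
  (a *: x + y).2 = a *: x.2 + y.2.
Proof. by []. Qed.

Section Homology.
Variable R : pzRingType.

(* ker d1 / im d2; only meant for d1 \o d2 = 0. *)
Definition homology (X2 X1 X0 : lmodType R)
    (d2 : {linear X2 -> X1}) (d1 : {linear X1 -> X0}) : lmodType R :=
  lquot [set z : kermod d1 | exists y, kval z = d2 y].

Section Map.
Variables (X2 X1 X0 Y2 Y1 Y0 : lmodType R).
Variables (d2 : {linear X2 -> X1}) (d1 : {linear X1 -> X0}).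
Variables (e2 : {linear Y2 -> Y1}) (e1 : {linear Y1 -> Y0}).
Variables (g2 : {linear X2 -> Y2}) (g1 : {linear X1 -> Y1}) (g0 : {linear X0 -> Y0}).
Hypothesis c1 : forall x, e1 (g1 x) = g0 (d1 x).
Hypothesis c2 : forall x, e2 (g2 x) = g1 (d2 x).

Let h := lin_comp (qproj [set z : kermod e1 | exists y, kval z = e2 y]) (kermap c1).

Fact homology_map_subproof (z : kermod d1) : (exists y, kval z = d2 y) -> h z = 0.
Proof.
case=> y zy; rewrite /h lin_compE -(linear0 (qproj _)); apply/qproj_eq.
by rewrite subr0; apply: span_mem; exists (g2 y); rewrite c2 -zy.
Qed.

Definition homology_map : {linear homology d2 d1 -> homology e2 e1} :=
  qlift homology_map_subproof.

Lemma homology_mapE z : homology_map (qproj _ z) = qproj _ (kermap c1 z).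
Proof. by rewrite /homology_map qliftE. Qed.
End Map.
End Homology.

Section Resolution.
Variable R : pzRingType.
Implicit Types A B C : lmodType R.

Definition free_map A B (f : A -> B) : {linear freemod R A -> freemod R B} :=
  flift (fun x => fbase (f x)).

(* The canonical free resolution ... -> F_1 -> F_0 -> A -> 0 with
   F_n = freemod R Z_n, where Z_0 = A and Z_(n+1) = ker (F_n -> Z_n); it is
   functorial in A.  Here res n A = F_n, syzn n A = Z_n and
   res_d n A : F_(n+1) -> F_n. *)
Definition aug A : {linear freemod R A -> A} := flift (fun x : A => x).

Lemma aug_nat A B (f : {linear A -> B}) x : aug B (free_map f x) = f (aug A x).
Proof.
apply: (free_ext (f := lin_comp (aug B) (free_map f)) (g := lin_comp f (aug A))).
by move=> a; rewrite !lin_compE !fliftE.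
Qed.

Definition syz A : lmodType R := kermod (aug A).
Definition syz_map A B (f : {linear A -> B}) : {linear syz A -> syz B} :=
  kermap (aug_nat f).

Definition syzn n A : lmodType R := iter n syz A.
Fixpoint syzn_map n A B (f : {linear A -> B}) : {linear syzn n A -> syzn n B} :=
  if n is n'.+1 then syz_map (syzn_map n' f) else f.

Definition res n A : lmodType R := freemod R (syzn n A).
Definition res_d n A : {linear res n.+1 A -> res n A} :=
  lin_comp (kincl (aug (syzn n A))) (aug (syzn n.+1 A)).
Definition res_map n A B (f : {linear A -> B}) : {linear res n A -> res n B} :=
  free_map (syzn_map n f).

Lemma res_map_d n A B (f : {linear A -> B}) x :
  res_d n B (res_map n.+1 f x) = res_map n f (res_d n A x).
Proof. by rewrite !lin_compE aug_nat. Qed.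

Lemma free_map_id A x : free_map (lin_id A) x = x.
Proof. by apply: (free_ext (g := lin_id _)) => a; rewrite fliftE. Qed.

Lemma syz_map_id A : syz_map (lin_id A) = lin_id (syz A).
Proof. by apply: lin_ext => x; apply: val_inj; exact: free_map_id. Qed.

Lemma free_map_comp A B C (g : {linear B -> C}) (f : {linear A -> B}) x :
  free_map (lin_comp g f) x = free_map g (free_map f x).
Proof.
apply: (free_ext (g := lin_comp (free_map g) (free_map f))) => a.
by rewrite lin_compE !fliftE.
Qed.

Lemma syz_map_comp A B C (g : {linear B -> C}) (f : {linear A -> B}) :
  syz_map (lin_comp g f) = lin_comp (syz_map g) (syz_map f).
Proof. by apply: lin_ext => x; apply: val_inj; exact: free_map_comp. Qed.

Lemma syzn_map_id n A : syzn_map n (lin_id A) = lin_id (syzn n A).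
Proof. by elim: n => //= n ->; exact: syz_map_id. Qed.

Lemma syzn_map_comp n A B C (g : {linear B -> C}) (f : {linear A -> B}) :
  syzn_map n (lin_comp g f) = lin_comp (syzn_map n g) (syzn_map n f).
Proof. by elim: n => //= n ->; exact: syz_map_comp. Qed.

Lemma res_map_id n A x : res_map n (lin_id A) x = x.
Proof. by rewrite /res_map syzn_map_id free_map_id. Qed.

Lemma res_map_comp n A B C (g : {linear B -> C}) (f : {linear A -> B}) x :
  res_map n (lin_comp g f) x = res_map n g (res_map n f x).
Proof. by rewrite /res_map syzn_map_comp free_map_comp. Qed.

End Resolution.
Arguments res_d : simpl never.
Arguments res_map : simpl never.

Section Tor.
Variable R : pzRingType.

(* Tor_1^R(B, A) = H_1(B (x)_R F), with F the canonical resolution of A. *)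
Definition Tor1 (B : bimod R) (A : lmodType R) : lmodType R :=
  homology (btens_map (bimod_id B) (res_d 1 A)) (btens_map (bimod_id B) (res_d 0 A)).

Section TwoTerm.
Implicit Types A : lmodType R.
Variables (K1 K0 : bimod R) (k : bimod_hom K1 K0).

(* For a two-term complex k : K1 -> K0 of bimodules, with K1 in cohomological
   degree -1 and K0 in degree 0, the term of degree -n of the total complex of
   K (x)_R F, F the canonical resolution of A, is tot_n A; the differential is
   d (x (x) y) = dx (x) y + (-1)^|x| x (x) dy.  The terms of F are free, so
   hyperTor1 A is H^-1 of the derived tensor product of K and A. *)
Definition tot0 A : lmodType R := btensor K0 (res 0 A).
Definition tot1 A : lmodType R := (btensor K1 (res 0 A) * btensor K0 (res 1 A))%type.
Definition tot2 A : lmodType R := (btensor K1 (res 1 A) * btensor K0 (res 2 A))%type.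

Definition tot_d1_fun A (x : tot1 A) : tot0 A :=
  btens_map k (lin_id _) x.1 + btens_map (bimod_id K0) (res_d 0 A) x.2.
Definition tot_d2_fun A (x : tot2 A) : tot1 A :=
  (- btens_map (bimod_id K1) (res_d 0 A) x.1,
   btens_map k (lin_id _) x.1 + btens_map (bimod_id K0) (res_d 1 A) x.2).

Fact tot_d1_linear A : linear (@tot_d1_fun A).
Proof.
by move=> a x y; rewrite /tot_d1_fun !pairP1 !pairP2 !linearP scalerDr addrACA.
Qed.
Fact tot_d2_linear A : linear (@tot_d2_fun A).
Proof.
move=> a x y; rewrite /tot_d2_fun !pairP1 !pairP2 !linearP; congr (_, _) => //=.
by rewrite scalerDr addrACA.
Qed.
Definition tot_d1 A := mklin (@tot_d1_linear A).
Definition tot_d2 A := mklin (@tot_d2_linear A).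

Lemma tot_d1E A x : tot_d1 A x =
  btens_map k (lin_id _) x.1 + btens_map (bimod_id K0) (res_d 0 A) x.2.
Proof. by []. Qed.
Lemma tot_d2E A x : tot_d2 A x = (- btens_map (bimod_id K1) (res_d 0 A) x.1,
   btens_map k (lin_id _) x.1 + btens_map (bimod_id K0) (res_d 1 A) x.2).
Proof. by []. Qed.

Definition hyperTor1 A : lmodType R := homology (tot_d2 A) (tot_d1 A).

Section Map.
Variables (A B : lmodType R) (f : {linear A -> B}).

Definition tot0_map : {linear tot0 A -> tot0 B} :=
  btens_map (bimod_id K0) (res_map 0 f).
Definition tot1_map_fun (x : tot1 A) : tot1 B :=
  (btens_map (bimod_id K1) (res_map 0 f) x.1,
   btens_map (bimod_id K0) (res_map 1 f) x.2).
Definition tot2_map_fun (x : tot2 A) : tot2 B :=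
  (btens_map (bimod_id K1) (res_map 1 f) x.1,
   btens_map (bimod_id K0) (res_map 2 f) x.2).
Fact tot1_map_linear : linear tot1_map_fun.
Proof. by move=> a x y; rewrite /tot1_map_fun pairP1 pairP2 !linearP. Qed.
Fact tot2_map_linear : linear tot2_map_fun.
Proof. by move=> a x y; rewrite /tot2_map_fun pairP1 pairP2 !linearP. Qed.
Definition tot1_map := mklin tot1_map_linear.
Definition tot2_map := mklin tot2_map_linear.

Lemma tot1_mapE x : tot1_map x =
  (btens_map (bimod_id K1) (res_map 0 f) x.1,
   btens_map (bimod_id K0) (res_map 1 f) x.2).
Proof. by []. Qed.

Fact tot_map_d1 x : tot_d1 B (tot1_map x) = tot0_map (tot_d1 A x).
Proof.
rewrite !tot_d1E [tot0_map _]linearD; congr (_ + _); first exact: btens_map_sq.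
by apply: btens_map_sq => // y; exact: res_map_d.
Qed.

Fact tot_map_d2 x : tot_d2 B (tot2_map x) = tot1_map (tot_d2 A x).
Proof.
rewrite !tot_d2E !tot1_mapE linearN linearD; congr (- _, _ + _).
- by apply: btens_map_sq => // y; exact: res_map_d.
- exact: btens_map_sq.
- by apply: btens_map_sq => // y; exact: res_map_d.
Qed.

Definition hyperTor1_map : {linear hyperTor1 A -> hyperTor1 B} :=
  homology_map tot_map_d1 tot_map_d2.

Lemma hyperTor1_mapE z :
  hyperTor1_map (qproj _ z) = qproj _ (kermap tot_map_d1 z).
Proof. exact: homology_mapE. Qed.
End Map.

Lemma hyperTor1_map_id A : hyperTor1_map (lin_id A) = lin_id _.
Proof.
apply: lin_ext => x; rewrite -[x]qreprK homology_mapE; congr (qproj _ _).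
apply: val_inj; rewrite [LHS]tot1_mapE [RHS]surjective_pairing; congr (_, _);
  by apply: btens_map_1 => // w; exact: res_map_id.
Qed.

Lemma hyperTor1_map_comp (A B C : lmodType R) (g : {linear B -> C}) (f : {linear A -> B}) :
  hyperTor1_map (lin_comp g f) = lin_comp (hyperTor1_map g) (hyperTor1_map f).
Proof.
apply: lin_ext => x; rewrite -[x]qreprK; move: (qrepr x) => z {x}.
rewrite lin_compE !hyperTor1_mapE.
congr (qproj _ _); apply: val_inj.
transitivity (tot1_map g (tot1_map f (kval z))); last by [].
rewrite [LHS]tot1_mapE [tot1_map f _]tot1_mapE [RHS]tot1_mapE; cbn [fst snd].
congr (_, _); apply: esym; apply: btens_map_comp => // w; exact/esym/res_map_comp.
Qed.

End TwoTerm.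
End Tor.

(* V as a left, resp. right, R-module by restriction of scalars along v. *)
Definition resl (R V : pzRingType) (v : {rmorphism R -> V}) : Type := V.
Definition resr (R V : pzRingType) (v : {rmorphism R -> V}) : Type := V.

Section RestrictionOfScalars.
Variables (R V : pzRingType) (v : {rmorphism R -> V}).
Local Notation resl := (resl v).
Local Notation resr := (resr v).

HB.instance Definition _ := GRing.Zmodule.copy resl V.
Definition resl_scale (r : R) (x : resl) : resl := v r * (x : V).
Fact resl_scaleA r s x : resl_scale r (resl_scale s x) = resl_scale (r * s) x.
Proof. by rewrite /resl_scale rmorphM mulrA. Qed.
Fact resl_scale1 : left_id 1 resl_scale.
Proof. by move=> x; rewrite /resl_scale rmorph1 mul1r. Qed.
Fact resl_scaleDr : right_distributive resl_scale +%R.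
Proof. by move=> r x y; exact: mulrDr. Qed.
Fact resl_scaleDl x : {morph resl_scale^~ x : r s / r + s}.
Proof. by move=> r s; rewrite /resl_scale rmorphD; exact: mulrDl. Qed.
HB.instance Definition _ := GRing.Zmodule_isLmodule.Build R resl
  resl_scaleA resl_scale1 resl_scaleDr resl_scaleDl.

HB.instance Definition _ := GRing.Zmodule.copy resr V.
Definition resr_scale (r : R^c) (x : resr) : resr := (x : V) * v r.
Fact resr_scaleA r s x : resr_scale r (resr_scale s x) = resr_scale (r * s) x.
Proof. by rewrite /resr_scale -mulrA -rmorphM. Qed.
Fact resr_scale1 : left_id 1 resr_scale.
Proof. by move=> x; rewrite /resr_scale (rmorph1 v) mulr1. Qed.
Fact resr_scaleDr : right_distributive resr_scale +%R.
Proof. by move=> r x y; exact: mulrDl. Qed.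
Fact resr_scaleDl x : {morph resr_scale^~ x : r s / r + s}.
Proof. by move=> r s; rewrite /resr_scale (rmorphD v); exact: mulrDr. Qed.
HB.instance Definition _ := GRing.Zmodule_isLmodule.Build R^c resr
  resr_scaleA resr_scale1 resr_scaleDr resr_scaleDl.

Fact resr_lact_linear (r : R) : linear (fun x : resr => v r * (x : V) : resr).
Proof.
move=> a x y; rewrite [LHS]mulrDr; congr (_ + _); exact: mulrA.
Qed.
Fact resr_lactA r s x : mklin (resr_lact_linear r) (mklin (resr_lact_linear s) x)
  = mklin (resr_lact_linear (r * s)) x.
Proof. by rewrite /= rmorphM mulrA. Qed.
Fact resr_lact1 x : mklin (resr_lact_linear 1) x = x.
Proof. by rewrite /= rmorph1 mul1r. Qed.
Fact resr_lactD r s x : mklin (resr_lact_linear (r + s)) x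
  = mklin (resr_lact_linear r) x + mklin (resr_lact_linear s) x.
Proof. by rewrite /= rmorphD; exact: mulrDl. Qed.

Definition ring_bimod : bimod R := Bimod resr_lactA resr_lact1 resr_lactD.

End RestrictionOfScalars.

Section Comodules.
Variables (R U : pzRingType) (u : {rmorphism R -> U}).

(* u is an epimorphism in the category of associative unital rings, the zero
   ring included. *)
Definition ring_epi : Prop :=
  forall (V : pzRingType) (f g : {rmorphism U -> V}),
    (forall r, f (u r) = g (u r)) -> forall x, f x = g x.

Definition comodule (M : lmodType R) : Prop :=
  (forall x : tensor (resr u) M, x = 0) /\ (forall x : Tor1 (ring_bimod u) M, x = 0).

(* The complex R -> U of bimodules, R in degree -1 and U in degree 0. *)
Fact Kdiff_linear :
  linear (u : ring_bimod (idfun : {rmorphism R -> R}) -> ring_bimod u).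
Proof.
move=> r x y; rewrite [LHS](rmorphD u); congr (_ + _); exact: rmorphM.
Qed.
Fact Kdiff_lact r x : mklin Kdiff_linear (lact (ring_bimod idfun) r x)
  = lact (ring_bimod u) r (mklin Kdiff_linear x).
Proof. exact: rmorphM. Qed.
Definition Kdiff : bimod_hom (ring_bimod (idfun : {rmorphism R -> R})) (ring_bimod u) :=
  BimodHom Kdiff_lact.

Definition Gamma (A : lmodType R) : lmodType R := hyperTor1 Kdiff A.
Definition Gamma_map (A B : lmodType R) (f : {linear A -> B}) :
  {linear Gamma A -> Gamma B} := hyperTor1_map Kdiff f.

End Comodules.

(* Categories enriched in abelian groups. *)
Record preadditive : Type := Preadditive {
  obj :> Type;
  hom : obj -> obj -> zmodType;
  idm : forall X, hom X X;
  comp : forall X Y Z, hom Y Z -> hom X Y -> hom X Z;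
  comp_assoc : forall X Y Z W (h : hom Z W) (g : hom Y Z) (f : hom X Y),
    comp h (comp g f) = comp (comp h g) f;
  comp_idl : forall X Y (f : hom X Y), comp (idm Y) f = f;
  comp_idr : forall X Y (f : hom X Y), comp f (idm X) = f;
  comp_addl : forall X Y Z (g g' : hom Y Z) (f : hom X Y),
    comp (g + g') f = comp g f + comp g' f;
  comp_addr : forall X Y Z (g : hom Y Z) (f f' : hom X Y),
    comp g (f + f') = comp g f + comp g f' }.
Arguments idm {p} X.
Arguments comp {p X Y Z} _ _.
Notation "g \c f" := (comp g f) (at level 40, left associativity).

Section CategoricalNotions.
Variable C : preadditive.
Implicit Types X Y Z : C.

Definition is_kernel K X Y (k : hom K X) (f : hom X Y) : Prop :=
  f \c k = 0 /\
  forall W (h : hom W X), f \c h = 0 -> exists! h' : hom W K, k \c h' = h.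

Definition is_cokernel X Y Q (q : hom Y Q) (f : hom X Y) : Prop :=
  q \c f = 0 /\
  forall W (h : hom Y W), h \c f = 0 -> exists! h' : hom Q W, h' \c q = h.

Definition short_exact X Y Z (i : hom X Y) (p : hom Y Z) : Prop :=
  is_kernel i p /\ is_cokernel p i.

Definition is_coproduct (I : Type) (X : I -> C) S (inj : forall i, hom (X i) S) : Prop :=
  forall W (g : forall i, hom (X i) W), exists! h : hom S W, forall i, h \c inj i = g i.

Definition is_biproduct X Y S (i1 : hom X S) (i2 : hom Y S)
    (p1 : hom S X) (p2 : hom S Y) : Prop :=
  [/\ p1 \c i1 = idm X, p2 \c i2 = idm Y, p1 \c i2 = 0, p2 \c i1 = 0
    & i1 \c p1 + i2 \c p2 = idm S].

Definition is_mono X Y (f : hom X Y) : Prop :=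
  forall W (g h : hom W X), f \c g = f \c h -> g = h.
Definition is_epi X Y (f : hom X Y) : Prop :=
  forall W (g h : hom Y W), g \c f = h \c f -> g = h.

Record is_abelian : Prop := IsAbelian {
  abelian_zero : exists Z : C, idm Z = 0;
  abelian_biproduct : forall X Y, exists S (i1 : hom X S) (i2 : hom Y S)
    (p1 : hom S X) (p2 : hom S Y), is_biproduct i1 i2 p1 p2;
  abelian_kernel : forall X Y (f : hom X Y), exists K (k : hom K X), is_kernel k f;
  abelian_cokernel : forall X Y (f : hom X Y), exists Q (q : hom Y Q), is_cokernel q f;
  abelian_mono : forall X Y (f : hom X Y),
    is_mono f -> exists Z (g : hom Y Z), is_kernel f g;
  abelian_epi : forall X Y (f : hom X Y),
    is_epi f -> exists Z (g : hom Z X), is_cokernel f g }.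

Variable P : C -> Prop.

Definition closed_under_kernels : Prop :=
  forall K X Y (k : hom K X) (f : hom X Y), is_kernel k f -> P X -> P Y -> P K.
Definition closed_under_cokernels : Prop :=
  forall X Y Q (q : hom Y Q) (f : hom X Y), is_cokernel q f -> P X -> P Y -> P Q.
Definition closed_under_extensions : Prop :=
  forall X Y Z (i : hom X Y) (p : hom Y Z), short_exact i p -> P X -> P Z -> P Y.
Definition closed_under_coproducts : Prop :=
  forall (I : Type) (X : I -> C) S (inj : forall i, hom (X i) S),
    is_coproduct inj -> (forall i, P (X i)) -> P S.

End CategoricalNotions.

Definition full_subcat (C : preadditive) (P : C -> Prop) : preadditive := @Preadditive {X : C | P X}
  (fun X Y => hom (sval X) (sval Y)) (fun X => idm (sval X))
  (fun X Y Z g f => g \c f)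
  (fun X Y Z W h g f => comp_assoc h g f) (fun X Y f => comp_idl f)
  (fun X Y f => comp_idr f) (fun X Y Z g g' f => comp_addl g g' f)
  (fun X Y Z g f f' => comp_addr g f f').

Record functor (C D : preadditive) : Type := Functor {
  fobj :> C -> D;
  fmap : forall X Y, hom X Y -> hom (fobj X) (fobj Y);
  fmap_id : forall X, fmap (idm X) = idm (fobj X);
  fmap_comp : forall X Y Z (g : hom Y Z) (f : hom X Y),
    fmap (g \c f) = fmap g \c fmap f }.
Arguments fmap {C D} _ {X Y} _.

Definition additive_functor (C D : preadditive) (F : functor C D) : Prop :=
  forall X Y (f g : hom X Y), fmap F (f + g) = fmap F f + fmap F g.

Definition exact_functor (C D : preadditive) (F : functor C D) : Prop :=
  additive_functor F /\
  forall X Y Z (i : hom X Y) (p : hom Y Z),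
    short_exact i p -> short_exact (fmap F i) (fmap F p).

Definition fully_faithful (C D : preadditive) (F : functor C D) : Prop :=
  forall X Y, bijective (fun f : hom X Y => fmap F f).

(* G is right adjoint to F: natural bijections Hom(F X, Y) = Hom(X, G Y). *)
Definition is_right_adjoint (C D : preadditive)
    (G : functor D C) (F : functor C D) : Prop :=
  exists phi : forall X Y, hom (F X) Y -> hom X (G Y),
    (forall X Y, bijective (phi X Y)) /\
    (forall X X' Y Y' (a : hom X' X) (b : hom Y Y') (f : hom (F X) Y),
       phi X' Y' (b \c f \c fmap F a) = fmap G b \c phi X Y f \c a).

Definition embedding (C : preadditive) (P : C -> Prop) :
  functor (full_subcat P) C :=
  @Functor (full_subcat P) C (fun X => sval X) (fun X Y f => f)
    (fun _ => erefl) (fun _ _ _ _ _ => erefl).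

Definition corestrict (C D : preadditive) (P : D -> Prop) (F : functor C D)
    (FP : forall X, P (F X)) : functor C (full_subcat P) :=
  @Functor C (full_subcat P) (fun X => exist P (F X) (FP X))
    (fun X Y f => fmap F f) (fmap_id F) (fmap_comp F).

Definition Mod (R : pzRingType) : preadditive.
Proof.
refine (@Preadditive (lmodType R) (fun M N => {linear M -> N} : zmodType)
  (@lin_id R) (@lin_comp R) _ _ _ _ _).
- by move=> *; apply: lin_ext.
- by move=> *; apply: lin_ext.
- by move=> *; apply: lin_ext.
- by move=> *; apply: lin_ext.
- by move=> *; apply: lin_ext => x; apply: linearD.
Defined.

Definition Gamma_functor (R U : pzRingType) (u : {rmorphism R -> U}) :
    functor (Mod R) (Mod R) :=
  @Functor (Mod R) (Mod R) (Gamma u) (@Gamma_map R U u)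
    (@hyperTor1_map_id _ _ _ _) (@hyperTor1_map_comp _ _ _ _).

Definition Comod (R U : pzRingType) (u : {rmorphism R -> U}) : preadditive :=
  @full_subcat (Mod R) (comodule u).

Definition Comod_embedding (R U : pzRingType) (u : {rmorphism R -> U}) :
  functor (Comod u) (Mod R) := @embedding (Mod R) (comodule u).

Definition Gamma_comod (R U : pzRingType) (u : {rmorphism R -> U})
    (GammaP : forall A, comodule u (Gamma u A)) : functor (Mod R) (Comod u) :=
  @corestrict (Mod R) (Mod R) (comodule u) (Gamma_functor u) GammaP.

(* Main.v *)
Require Import Defs.
From HB Require Import structures.
From mathcomp Require Import all_boot all_algebra.
From mathcomp Require Import boolp classical_sets.

(** Let [0 -> F1 -> F0 -> U -> 0] be a flat resolution of the right module [U],
    with first map [i].  Then [Tor_1(U, M)] is the kernel of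
    [F1 (x) M -> F0 (x) M], so [M] is a comodule exactly when this map is
    injective ([M] is [acyclic]) and [U (x) M = 0] ([comoduleP]).  The comparison
    with the canonical free resolution of [M] rests on free modules being
    acyclic.

    Part (a).  Submodules of acyclic modules are acyclic, because [F1] is flat;
    this replaces the vanishing of [Tor_2(U, -)].  The snake lemma for
    [0 -> L -> X -> N -> 0] gives three further facts: if [N] is acyclic then
    [U (x) L -> U (x) X] is injective; if this map is injective and [X] is
    acyclic then [N] is acyclic; acyclicity passes to extensions.  The closure
    properties follow by splitting a linear map through its image.  Kernels and
    cokernels of modules being comodules again, kernels and cokernels in the
    category of comodules are those of modules ([is_kernel_comodP],
    [is_cokernel_comodP]), whence the abelian structure and exactness.

    Part (b).  Since [R -> U] is an epimorphism, the unit [Y -> U (x) Y] is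
    bijective for every [Y = U (x) X] ([epi_pure]); together with
    [Tor_1(U, U) = 0] this makes [U (x) X] acyclic whenever [X] is
    ([acyclic_extend]).  Let [P -> A] be the free cover with kernel [Z], and let
    [E] be the pushout of [Z -> P] and [Z -> U (x) Z] (called [middle] below).
    There are exact sequences

      [0 -> Gamma A -> E -> U (x) P]   and   [0 -> U (x) Z -> E -> A -> 0]

    ([Gamma_middle_ker], [middle_exact]).  In the first one [E] is acyclic and
    [U (x) E -> U (x) (U (x) P)] is injective, so [Gamma A] is a comodule
    ([Gamma_comodule]).  If [M] is a comodule, then
    [Hom(M, U (x) X) = 0 = Ext^1(M, U (x) X)] for all [X] ([hom_extend_zero],
    [extension_retraction]); so the two sequences give
    [Hom(M, Gamma A) = Hom(M, E) = Hom(M, A)], composition with the natural map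
    [Gamma A -> A] ([Gamma_universal]). *)

Set Implicit Arguments.
Unset Strict Implicit.
Unset Printing Implicit Defensive.

Import GRing.Theory.
Local Open Scope classical_set_scope.
Local Open Scope ring_scope.

Local Notation span := Defs.span.

(** * Submodules and quotients *)

Section Submodules.
Variable R : pzRingType.
Implicit Types V W X : lmodType R.

Lemma qproj0P V (S : set V) x : qproj S x = 0 <-> span S x.
Proof. by rewrite -(linear0 (qproj S)) (qproj_eq S x 0) subr0. Qed.

Lemma span_range V W (f : {linear W -> V}) x :
  span [set f w | w in setT] x <-> exists w, f w = x.
Proof.
split=> [|[w <-]]; last by apply: span_mem; exists w.
elim=> {x} [|x [w _ <-]|x y _ [w <-] _ [w' <-]|a x _ [w <-]].
- by exists 0; rewrite linear0.
- by exists w.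
- by exists (w + w'); rewrite linearD.
- by exists (a *: w); rewrite linearZ.
Qed.

(** A set on which linear maps are determined spans: compare the projection
    onto the quotient by its span with the zero map. *)
Lemma span_of_ext V (S : set V) :
  (forall W (f g : {linear V -> W}), (forall x, S x -> f x = g x) -> f =1 g) ->
  forall x, span S x.
Proof.
move=> ext x; apply/qproj0P; apply: (ext _ (qproj S) (lin_zero V (lquot S))) => y Sy.
exact/qproj0P/span_mem.
Qed.

Lemma linear_inj0 V W (f : {linear V -> W}) :
  (forall x, f x = 0 -> x = 0) -> injective f.
Proof.
move=> f0 x y /eqP; rewrite -subr_eq0 -linearB => /eqP/f0/eqP.
by rewrite subr_eq0 => /eqP.
Qed.

Lemma linear_lift V W X (k : {linear W -> X}) (h : {linear V -> X}) :
  injective k -> (forall v, exists w, k w = h v) ->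
  exists h' : {linear V -> W}, forall v, k (h' v) = h v.
Proof.
move=> kI hk; have [g gE] := choice hk.
have gl : linear g by move=> a x y; apply: kI; rewrite linearP !gE linearP.
by exists (mklin gl).
Qed.

Lemma linear_descend V W X (q : {linear V -> X}) (h : {linear V -> W}) :
  (forall x, exists v, q v = x) -> (forall v, q v = 0 -> h v = 0) ->
  exists h' : {linear X -> W}, forall v, h' (q v) = h v.
Proof.
move=> qS hq; have [s sE] := choice qS.
have qh v v' : q v = q v' -> h v = h v'.
  move=> vv'; apply/eqP; rewrite -subr_eq0 -linearB; apply/eqP/hq.
  by rewrite linearB vv' subrr.
have hl : linear (fun x => h (s x)).
  by move=> a x y; rewrite -linearP; apply: qh; rewrite linearP !sE.
by exists (mklin hl) => v; apply: qh; rewrite sE.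
Qed.

Lemma kincl_range V W (f : {linear V -> W}) x :
  f x = 0 <-> exists w, kincl f w = x.
Proof.
split=> [fx|[w <-]]; last exact/eqP/(kvalP w).
have kx : x \in in_ker f by apply/eqP.
by exists (Kermod kx).
Qed.

End Submodules.

Section Coker.
Variables (R : pzRingType) (X Y : lmodType R) (f : {linear X -> Y}).

Definition coker : lmodType R := lquot [set f x | x in setT].
Definition coker_proj : {linear Y -> coker} := qproj _.

Lemma coker_proj0P y : coker_proj y = 0 <-> exists x, f x = y.
Proof. by rewrite qproj0P; exact: span_range. Qed.
Lemma coker_proj_surj z : exists y, coker_proj y = z.
Proof. by exists (qrepr z); exact: qreprK. Qed.

Section Lift.
Variables (W : lmodType R) (h : {linear Y -> W}).
Hypothesis hf : forall x, h (f x) = 0.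

Fact coker_lift_subproof y : [set f x | x in setT] y -> h y = 0.
Proof. by case=> x _ <-. Qed.
Definition coker_lift : {linear coker -> W} := qlift coker_lift_subproof.

Lemma coker_liftE y : coker_lift (coker_proj y) = h y.
Proof. exact: qliftE. Qed.
End Lift.
End Coker.
Arguments coker_proj {R X Y} f : simpl never.
Arguments coker_lift : simpl never.

(** * Tensor products *)

Lemma int_linear (V W : lmodType int) (f : V -> W) :
  {morph f : x y / x + y} -> linear f.
Proof.
move=> fD.
have f0 : f 0 = 0 by apply: (addrI (f 0)); rewrite -fD !addr0.
have fN x : f (- x) = - f x.
  by apply: (addrI (f x)); rewrite -fD !subrr.
have fn n x : f (x *+ n) = f x *+ n.
  by elim: n => [|n IH]; rewrite ?mulr0n // !mulrS fD IH.
have E (X : lmodType int) (a : int) (x : X) : a *: x = x *~ a.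
  by rewrite -[a in LHS]intz scaler_int.
move=> a x y; rewrite fD !E; congr (_ + _).
by case: a => n; rewrite ?NegzE ?mulrNz ?fN -!pmulrn fn.
Qed.

Section TensorTools.
Variable R : pzRingType.
Implicit Types (N : lmodType R^c) (M : lmodType R) (G : lmodType int).

Section Lift.
Variables (N : lmodType R^c) (M : lmodType R) (G : lmodType int).
Variable b : N -> M -> G.
Hypothesis bDl : forall n n' m, b (n + n') m = b n m + b n' m.
Hypothesis bDr : forall n m m', b n (m + m') = b n m + b n m'.
Hypothesis bZ : forall n (r : R) m, b ((r : R^c) *: n) m = b n (r *: m).

Let h := flift (fun p : N * M => b p.1 p.2).

Fact tens_lift_subproof x : tens_rel x -> h x = 0.
Proof.
case=> {x} [n n' m|n m m'|n r m]; rewrite !linearB /h !fliftE /=.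
- by rewrite bDl -addrA -opprD subrr.
- by rewrite bDr -addrA -opprD subrr.
- by rewrite bZ subrr.
Qed.
Definition tens_lift : {linear tensor N M -> G} := qlift tens_lift_subproof.

Lemma tens_liftE n m : tens_lift (pure n m) = b n m.
Proof. by rewrite /tens_lift /pure qliftE /h fliftE. Qed.
End Lift.

Lemma tensor_span N M (z : tensor N M) : span [set pure p.1 p.2 | p in setT] z.
Proof.
apply: span_of_ext => G f g fg; apply: tensor_ext => n m.
by apply: fg; exists (n, m).
Qed.

Lemma pure0l N M (m : M) : pure (0 : N) m = 0.
Proof. by apply: (addrI (pure 0 m)); rewrite -pureDl !addr0. Qed.
Lemma pure0r N M (n : N) : pure n (0 : M) = 0.
Proof. by apply: (addrI (pure n 0)); rewrite -pureDr !addr0. Qed.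
Lemma pureNl N M (n : N) (m : M) : pure (- n) m = - pure n m.
Proof. by apply: (addrI (pure n m)); rewrite -pureDl !subrr pure0l. Qed.
Lemma pureNr N M (n : N) (m : M) : pure n (- m) = - pure n m.
Proof. by apply: (addrI (pure n m)); rewrite -pureDr !subrr pure0r. Qed.

Lemma span_int_ind (G : lmodType int) (S : set G) (P : G -> Prop) :
  P 0 -> (forall x, S x -> P x) -> (forall x y, P x -> P y -> P (x + y)) ->
  (forall x, P x -> P (- x)) -> forall x, span S x -> P x.
Proof.
move=> P0 PS PD PN x; elim=> {x} [//|x /PS //|x y _ Px _ Py|a x _ Px]; first exact: PD.
rewrite -[a]intz scaler_int.
have Pn n : P (x *+ n) by elim: n => [|n IH]; rewrite ?mulr0n // mulrS; apply: PD.
by case: a => n; rewrite ?NegzE ?mulrNz -!pmulrn; [|apply: PN].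
Qed.

Lemma tensor_ind N M (P : tensor N M -> Prop) :
  (forall n m, P (pure n m)) -> (forall x y, P x -> P y -> P (x + y)) ->
  forall z, P z.
Proof.
move=> Pp PD z; have P0 : P 0 by rewrite -(pure0l N (0 : M)); exact: Pp.
suff [//] : P z /\ P (- z).
have := tensor_span z; apply: (span_int_ind (P := fun z => P z /\ P (- z))).
- by rewrite oppr0.
- by move=> _ [[n m] _ <-] /=; rewrite -pureNl.
- by move=> x y [? ?] [? ?]; rewrite opprD; split; apply: PD.
- by move=> x [? ?]; rewrite opprK.
Qed.

(** Right exactness of the tensor product, in both variables at once.  Modulo
    the listed tensors, [pure n m] depends only on [f n] and [g m]; hence
    choosing preimages defines a map from [tensor N' M'] to the quotient by these
    tensors, and its composite with [tens_map f g] is the projection. *)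
Lemma tens_map_ker N N' M M' (f : {linear N -> N'}) (g : {linear M -> M'}) :
  (forall n', exists n, f n = n') -> (forall m', exists m, g m = m') ->
  forall z, tens_map f g z = 0 ->
  span [set pure p.1 p.2 | p in [set p | f p.1 = 0 \/ g p.2 = 0]] z.
Proof.
move=> fS gS; set S := [set pure p.1 p.2 | p in _].
have [s sE] := choice fS; have [t tE] := choice gS.
have fk n n' m : f n = f n' -> qproj S (pure n m) = qproj S (pure n' m).
  move=> nn'; apply/qproj_eq; rewrite -pureNl -pureDl; apply: span_mem.
  by exists (n - n', m) => //; left; rewrite linearB nn' subrr.
have gk n m m' : g m = g m' -> qproj S (pure n m) = qproj S (pure n m').
  move=> mm'; apply/qproj_eq; rewrite -pureNr -pureDr; apply: span_mem.
  by exists (n, m - m') => //; right; rewrite linearB mm' subrr.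
pose b n' m' := qproj S (pure (s n') (t m')).
have bDl n n' m : b (n + n') m = b n m + b n' m.
  rewrite /b (fk _ (s n + s n')) ?linearD ?sE // pureDl.
  exact: linearD.
have bDr n m m' : b n (m + m') = b n m + b n m'.
  rewrite /b (gk _ _ (t m + t m')) ?linearD ?tE // pureDr.
  exact: linearD.
have bZ n (r : R) m : b ((r : R^c) *: n) m = b n (r *: m).
  rewrite /b (fk _ ((r : R^c) *: s n)) ?linearZ ?sE //= pureZ.
  by rewrite (gk _ _ (t (r *: m))) // linearZ /= !tE.
move=> z fgz; apply/qproj0P.
rewrite -(linear0 (tens_lift bDl bDr bZ)) -fgz.
apply/esym; move: z {fgz}.
apply: (tensor_ext (f := lin_comp (tens_lift bDl bDr bZ) (tens_map f g))
  (g := qproj S)) => n m.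
rewrite lin_compE tens_mapE tens_liftE /b.
by rewrite (fk _ n) ?sE // (gk _ _ m) // tE.
Qed.

Lemma tens_map_surj N N' M M' (f : {linear N -> N'}) (g : {linear M -> M'}) :
  (forall n', exists n, f n = n') -> (forall m', exists m, g m = m') ->
  forall z', exists z, tens_map f g z = z'.
Proof.
move=> fS gS; apply: tensor_ind => [n' m'|x y [z <-] [z' <-]].
- have [n <-] := fS n'; have [m <-] := gS m'.
  by exists (pure n m); rewrite tens_mapE.
- by exists (z + z'); rewrite linearD.
Qed.

Lemma tens_map_exact_r N M M' M'' (f : {linear M -> M'}) (g : {linear M' -> M''}) :
  (forall y, exists x, g x = y) -> (forall x, g x = 0 -> exists w, f w = x) ->
  forall z, tens_map (lin_id N) g z = 0 -> exists w, tens_map (lin_id N) f w = z.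
Proof.
move=> gS gf z /tens_map_ker-/(_ _ gS) zS; apply/span_range.
have /zS : forall n : N, exists n0, lin_id N n0 = n by move=> n; exists n.
elim=> {z zS} [|_ [[n m] /= [n0|/gf[w <-]] <-]|x y _ ? _ ?|a x _ ?].
- exact: span_zero.
- by rewrite [n]n0 pure0l; exact: span_zero.
- by rewrite -[n]/(lin_id N n) -tens_mapE; apply: span_mem; exists (pure n w).
- exact: span_add.
- exact: span_scale.
Qed.

Lemma tens_map_exact_l N N' N'' M (f : {linear N -> N'}) (g : {linear N' -> N''}) :
  (forall y, exists x, g x = y) -> (forall x, g x = 0 -> exists w, f w = x) ->
  forall z, tens_map g (lin_id M) z = 0 -> exists w, tens_map f (lin_id M) w = z.
Proof.
move=> gS gf z /(tens_map_ker gS) zS; apply/span_range.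
have /zS : forall m : M, exists m0, lin_id M m0 = m by move=> m; exists m.
elim=> {z zS} [|_ [[n m] /= [/gf[w <-]|m0] <-]|x y _ ? _ ?|a x _ ?].
- exact: span_zero.
- by rewrite -[m]/(lin_id M m) -tens_mapE; apply: span_mem; exists (pure w m).
- by rewrite [m]m0 pure0r; exact: span_zero.
- exact: span_add.
- exact: span_scale.
Qed.

Lemma tens_map_comp N N' N'' M M' M'' (f : {linear N -> N'}) (f' : {linear N' -> N''})
    (g : {linear M -> M'}) (g' : {linear M' -> M''}) z :
  tens_map f' g' (tens_map f g z) = tens_map (lin_comp f' f) (lin_comp g' g) z.
Proof.
apply: (tensor_ext (f := lin_comp (tens_map f' g') (tens_map f g))) => n m.
by rewrite lin_compE !tens_mapE.
Qed.

Lemma tens_map_zero N N' M M' (f : {linear N -> N'}) (g : {linear M -> M'}) :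
  (forall m, g m = 0) -> forall z, tens_map f g z = 0.
Proof.
move=> g0; apply: (tensor_ext (g := lin_zero (tensor N M) (tensor N' M'))) => n m.
by rewrite tens_mapE g0 pure0r.
Qed.

Lemma tens_map_swap N N' M M' (f : {linear N -> N'}) (g : {linear M -> M'}) z :
  tens_map f (lin_id M') (tens_map (lin_id N) g z) =
  tens_map (lin_id N') g (tens_map f (lin_id M) z).
Proof.
rewrite !tens_map_comp; move: z; apply: tensor_ext => n m.
by rewrite !tens_mapE.
Qed.

End TensorTools.

(** * Vanishing of Tor_1 along a flat resolution *)

Definition exact_seq (R : pzRingType) (L X N : lmodType R)
    (f : {linear L -> X}) (g : {linear X -> N}) : Prop :=
  [/\ injective f, forall y, exists x, g x = y
    & forall x, g x = 0 <-> exists w, f w = x].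

Lemma exact_seq_ker (R : pzRingType) (X N : lmodType R) (g : {linear X -> N}) :
  (forall y, exists x, g x = y) -> exact_seq (kincl g) g.
Proof.
move=> gS; by split=> // [|x]; [exact: val_inj | exact: kincl_range].
Qed.

Section Regular.
Variables (R : pzRingType) (N : lmodType R^c).

Let b (n : N) (r : R^o) : zmodule N := (r : R^c) *: n.
Fact regular_bDl n n' r : b (n + n') r = b n r + b n' r.
Proof. exact: (@scalerDr _ N). Qed.
Fact regular_bDr n r r' : b n (r + r') = b n r + b n r'.
Proof. exact: (@scalerDl _ N). Qed.
Fact regular_bZ n (r : R) r' : b ((r : R^c) *: n) r' = b n (r *: r').
Proof. by rewrite /b scalerA. Qed.

Definition tens_regular : {linear tensor N R^o -> zmodule N} :=
  tens_lift regular_bDl regular_bDr regular_bZ.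

Lemma tens_regularE n (r : R^o) : tens_regular (pure n r) = (r : R^c) *: n.
Proof. exact: tens_liftE. Qed.
End Regular.

Section Acyclic.
Variables (R : pzRingType) (F1 F0 B : lmodType R^c).
Variables (i : {linear F1 -> F0}) (p : {linear F0 -> B}).
Hypotheses (flat1 : is_flat F1) (flat0 : is_flat F0).
Hypotheses (ip : exact_seq i p).
Implicit Types L X N S : lmodType R.

Let iI : injective i. Proof. by case: ip. Qed.
Let pS : forall y, exists x, p x = y. Proof. by case: ip. Qed.
Let pi0 x : p (i x) = 0.
Proof. by case: ip => _ _ pK; apply/pK; exists x. Qed.
Let pK x : p x = 0 -> exists w, i w = x.
Proof. by case: ip => _ _ pK /pK. Qed.

(** The flat resolution computes [Tor_1(B, M)] as the kernel of this map. *)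
Definition acyclic M := injective (tens_map i (lin_id M)).

Local Notation tl f := (tens_map (lin_id _) f).
Local Notation tr h := (tens_map h (lin_id _)).

Lemma acyclic_sub L X (f : {linear L -> X}) : injective f -> acyclic X -> acyclic L.
Proof.
move=> fI aX; apply: linear_inj0 => z iz.
apply: (flat1 fI); rewrite linear0; apply: aX.
by rewrite linear0 tens_map_swap iz linear0.
Qed.

Section Sequence.
Variables (L X N : lmodType R) (f : {linear L -> X}) (g : {linear X -> N}).
Hypothesis fg : exact_seq f g.

Let fI : injective f. Proof. by case: fg. Qed.
Let gS : forall y, exists x, g x = y. Proof. by case: fg. Qed.
Let gf0 (T : lmodType R^c) (z : tensor T L) : tl g (tl f z) = 0.
Proof.
rewrite tens_map_comp; apply: tens_map_zero => x /=.
by case: fg => _ _ gK; apply/gK; exists x.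
Qed.
Let gK (T : lmodType R^c) (z : tensor T X) : tl g z = 0 -> exists w, tl f w = z.
Proof. by apply: tens_map_exact_r => // x; case: fg => _ _ gK /gK. Qed.
Let pi0t M (z : tensor F1 M) : tr p (tr i z) = 0.
Proof.
rewrite tens_map_comp; move: z.
apply: (tensor_ext (g := lin_zero (tensor F1 M) (tensor B M))) => n m.
by rewrite tens_mapE /= pi0 pure0l.
Qed.
Let pKt M (z : tensor F0 M) : tr p z = 0 -> exists w, tr i w = z.
Proof. exact: tens_map_exact_l. Qed.
Let pSt M (z : tensor B M) : exists w, tr p w = z.
Proof. by apply: tens_map_surj => // m; exists m. Qed.
Let gSt (T : lmodType R^c) (z : tensor T N) : exists w, tl g w = z.
Proof. by apply: tens_map_surj => // m; exists m. Qed.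

(** The kernel of [B (x) L -> B (x) X] is the image of the connecting map from
    [Tor_1(B, N) = 0]. *)
Lemma acyclic_tens_inj : acyclic N -> injective (tens_map (lin_id B) f).
Proof.
move=> aN; apply: linear_inj0 => t ft; have [w wt] := pSt t.
have [v iv] : exists v, tr i v = tl f w.
  by apply: pKt; rewrite tens_map_swap wt.
have [v' fv'] : exists v', tl f v' = v.
  by apply: gK; apply: aN; rewrite linear0 tens_map_swap iv gf0.
rewrite -wt -[w](_ : tr i v' = w) ?pi0t //.
by apply: (flat0 fI); rewrite -tens_map_swap fv'.
Qed.

(** Conversely, [Tor_1(B, N)] lies between [Tor_1(B, X) = 0] and the kernel of
    [B (x) L -> B (x) X]. *)
Lemma acyclic_quotient :
  acyclic X -> injective (tens_map (lin_id B) f) -> acyclic N.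
Proof.
move=> aX ftI; apply: linear_inj0 => z iz; have [v vz] := gSt z.
have [w fw] : exists w, tl f w = tr i v.
  by apply: gK; rewrite -tens_map_swap vz.
have [w' iw'] : exists w', tr i w' = w.
  by apply: pKt; apply: ftI; rewrite -tens_map_swap fw pi0t linear0.
rewrite -vz -[v](_ : tl f w' = v) ?gf0 //.
by apply: aX; rewrite tens_map_swap iw'.
Qed.

Lemma acyclic_extension : acyclic L -> acyclic N -> acyclic X.
Proof.
move=> aL aN; apply: linear_inj0 => z iz.
have [w wz] : exists w, tl f w = z.
  by apply: gK; apply: aN; rewrite linear0 tens_map_swap iz linear0.
rewrite -wz [w](_ : w = 0) ?linear0 //; apply: aL; apply: (flat0 fI).
by rewrite -tens_map_swap wz iz !linear0.
Qed.
End Sequence.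

(** A form of the direct sum decomposition of [S] that is inherited by
    [tensor N S]: the bound [s] is enlarged at will, so that the condition is
    additive in [x]. *)
Definition is_sum (I : eqType) (X : I -> lmodType R) S
    (inj : forall j, {linear X j -> S}) (proj : forall j, {linear S -> X j}) :=
  forall x, exists s : seq I, forall t, uniq t -> {subset s <= t} ->
    \sum_(j <- t) inj j (proj j x) = x.

(** A tensor over [S] is the sum of its components, and those of an element of
    the kernel vanish. *)
Lemma acyclic_sum (I : eqType) (X : I -> lmodType R) S
    (inj : forall j, {linear X j -> S}) (proj : forall j, {linear S -> X j}) :
  is_sum inj proj -> (forall j, acyclic (X j)) -> acyclic S.
Proof.
move=> sumS aX; apply: linear_inj0 => z iz.
have pz j : tl (proj j) z = 0.
  by apply: (aX j); rewrite tens_map_swap iz !linear0.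
suff [s sE] : exists s : seq I, forall t, uniq t -> {subset s <= t} ->
    \sum_(j <- t) tl (inj j) (tl (proj j) z) = z.
  rewrite -[z](sE (undup s)) ?undup_uniq => [|//|x]; last by rewrite mem_undup.
  by rewrite big1 // => j _; rewrite pz linear0.
move: z {iz pz}; apply: tensor_ind => [n m|x y [s sE] [s' sE']].
- have [s sE] := sumS m; exists s => t Ut st.
  rewrite (eq_bigr (fun j => pure n (inj j (proj j m)))) => [|j _]; last first.
    by rewrite !tens_mapE.
  rewrite -[in RHS](sE t Ut st).
  by rewrite (big_morph (pure n) (pureDr n) (pure0r _ n)).
- exists (s ++ s') => t Ut st.
  rewrite -[in RHS](sE t) => [|//|j js]; last by apply: st; rewrite mem_cat js.
  rewrite -[in RHS](sE' t) => [|//|j js]; last by apply: st; rewrite mem_cat js orbT.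
  by rewrite -big_split; apply: eq_bigr => j _; rewrite !linearD.
Qed.

(** As [N (x) R] is [N], the map in question is [i]. *)
Lemma acyclic_regular : acyclic R^o.
Proof.
apply: linear_inj0 => z.
have [n ->] : exists n, z = pure n (1 : R^o).
  move: z; apply: tensor_ind => [n r|_ _ [n ->] [n' ->]].
    by exists ((r : R^c) *: n); rewrite pureZ /GRing.scale /= mulr1.
  by exists (n + n'); rewrite pureDl.
rewrite tens_mapE => /(congr1 (tens_regular F0)).
rewrite tens_regularE linear0 scale1r => i0.
by rewrite (_ : n = 0) ?pure0l //; apply: iI; rewrite i0 linear0.
Qed.

End Acyclic.

Section FreeSum.
Variables (R : pzRingType) (S : choiceType).

Fact fcoord_linear (s : S) : linear (fun q : freemod R S => (q s : R^o)).
Proof. by []. Qed.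
Definition fcoord s := mklin (fcoord_linear s).

Fact fscale_linear (s : S) : linear (fun r : R^o => (r : R) *: (fbase s : freemod R S)).
Proof. by move=> a x y; rewrite scalerDl scalerA. Qed.
Definition fscale s := mklin (fscale_linear s).

Lemma free_is_sum : is_sum fscale fcoord.
Proof.
move=> q; have [r Ur qr] := freemod_supp q; exists r => t Ut rt.
transitivity (flift (fun x => fbase x : freemod R S) q).
  by rewrite /flift /= (@fsumE _ _ _ _ t) // => x /qr/rt.
by apply: (free_ext (g := lin_id _)) => x; rewrite fliftE.
Qed.

End FreeSum.

(** * Tor_1 and comodules *)

Lemma image_factorization (R : pzRingType) (X Y : lmodType R) (f : {linear X -> Y}) :
  exists (I : lmodType R) (g : {linear X -> I}) (m : {linear I -> Y}),
  [/\ forall y, exists x, g x = y, injective m & forall x, m (g x) = f x].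
Proof.
pose c := coker_proj f.
have kI : injective (kincl c) by exact: val_inj.
have [|g gE] := linear_lift (h := f) kI.
  by move=> x; apply/kincl_range/coker_proj0P; exists x.
exists (kermod c), g, (kincl c); split=> // y.
have /eqP/coker_proj0P[x fx] := kvalP y.
by exists x; apply: kI; rewrite gE fx.
Qed.

Section Pairs.
Variables (R : pzRingType) (X Y : lmodType R).

Fact lin_fst_linear : linear (fun x : X * Y => x.1). Proof. by []. Qed.
Fact lin_snd_linear : linear (fun x : X * Y => x.2). Proof. by []. Qed.
Fact lin_inl_linear : linear (fun x : X => (x, 0) : X * Y).
Proof. by move=> a x y; congr (_, _); rewrite /= ?scaler0 ?addr0. Qed.
Fact lin_inr_linear : linear (fun y : Y => (0, y) : X * Y).
Proof. by move=> a x y; congr (_, _); rewrite /= ?scaler0 ?addr0. Qed.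

Definition lin_fst : {linear (X * Y)%type -> X} := mklin lin_fst_linear.
Definition lin_snd : {linear (X * Y)%type -> Y} := mklin lin_snd_linear.
Definition lin_inl : {linear X -> (X * Y)%type} := mklin lin_inl_linear.
Definition lin_inr : {linear Y -> (X * Y)%type} := mklin lin_inr_linear.

Lemma prod_exact : exact_seq lin_inl lin_snd.
Proof.
split=> [x y [] //|y|[x y]]; first by exists (0, y).
by split=> [/= ->|[w [_ <-]] //]; exists x.
Qed.
End Pairs.

Lemma homology0P (R : pzRingType) (X2 X1 X0 : lmodType R)
    (d2 : {linear X2 -> X1}) (d1 : {linear X1 -> X0}) :
  (forall x : homology d2 d1, x = 0) <->
  (forall z, d1 z = 0 -> exists y, z = d2 y).
Proof.
split=> [H0 z dz|H0 x].
- have kz : z \in in_ker d1 by apply/eqP.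
  have /qproj0P := H0 (qproj _ (Kermod kz)).
  suff gen (w : kermod d1) : span [set z | exists y, kval z = d2 y] w ->
      exists y, kval w = d2 y by move=> /gen.
  elim=> {w} [|//|x y _ [x' E] _ [y' E']|a x _ [x' E]].
  + by exists 0; rewrite linear0.
  + by exists (x' + y'); rewrite linearD -E -E'.
  + by exists (a *: x'); rewrite linearZ -E.
- rewrite -[x]qreprK; apply/qproj0P; apply: span_mem.
  exact/H0/eqP/kvalP.
Qed.

Lemma aug_surj (R : pzRingType) (A : lmodType R) y : exists x, aug A x = y.
Proof. by exists (fbase y); rewrite fliftE. Qed.

Lemma syz_exact (R : pzRingType) (A : lmodType R) : exact_seq (kincl (aug A)) (aug A).
Proof. exact/exact_seq_ker/aug_surj. Qed.

(** The image of [res_d 1 A] being the kernel of the augmentation of [syz A],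
    tensoring turns the degree one homology into a kernel. *)
Lemma tens_aug_ker (R : pzRingType) (B : lmodType R^c) (A : lmodType R) z :
  tens_map (lin_id B) (aug (syz A)) z = 0 ->
  exists w, tens_map (lin_id B) (res_d 1 A) w = z.
Proof.
apply: tens_map_exact_r => [|x ax]; first exact: aug_surj.
have kx : x \in in_ker (aug (syz A)) by apply/eqP.
by have [w wx] := aug_surj (Kermod kx); exists w; rewrite /res_d lin_compE wx.
Qed.

Lemma Tor1_zeroP (R : pzRingType) (B : bimod R) (A : lmodType R) :
  (forall x : Tor1 B A, x = 0) <->
  injective (tens_map (lin_id B) (kincl (aug A))).
Proof.
have dE z : tens_map (lin_id B) (res_d 0 A) z =
    tens_map (lin_id B) (kincl (aug A)) (tens_map (lin_id B) (aug (syz A)) z).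
  by rewrite tens_map_comp; move: z; apply: tensor_ext => n m; rewrite !tens_mapE.
split=> [/homology0P H0|kI].
- apply: linear_inj0 => z kz.
  have [w wz] : exists w, tens_map (lin_id B) (aug (syz A)) w = z.
    by apply: tens_map_surj; [move=> n; exists n|exact: aug_surj].
  have /H0[y wy] : btens_map (bimod_id B) (res_d 0 A) w = 0.
    by rewrite [LHS]dE wz kz.
  rewrite -wz wy [LHS]tens_map_comp; apply: tens_map_zero => m.
  by rewrite lin_compE; apply/eqP/(kvalP (aug (syzn 2 A) m)).
- apply/homology0P => z /=; rewrite [LHS in LHS = _ -> _]dE => kz.
  have /tens_aug_ker[w <-] : tens_map (lin_id B) (aug (syz A)) z = 0.
    by apply: kI; rewrite kz linear0.
  by exists w.
Qed.

Section Comodule.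
Variables (R U : pzRingType) (u : {rmorphism R -> U}).
Implicit Types A K X Y Q : lmodType R.
Variables (F1 F0 : lmodType R^c).
Variables (i : {linear F1 -> F0}) (p : {linear F0 -> resr u}).
Hypotheses (flat1 : is_flat F1) (flat0 : is_flat F0).
Hypotheses (ip : exact_seq i p).

Lemma acyclic_free (S : choiceType) : acyclic i (freemod R S).
Proof.
by apply: (acyclic_sum (@free_is_sum R S)) => s; exact: (acyclic_regular ip).
Qed.

(** Both conditions say that [U (x) syz A -> U (x) P] is injective, for the free
    cover [P] of [A]: the first by [Tor1_zeroP], the second by the snake lemma,
    [P] being acyclic. *)
Lemma acyclicP A : (forall x : Tor1 (ring_bimod u) A, x = 0) <-> acyclic i A.
Proof.
split=> [/Tor1_zeroP kI|aA]; last apply/Tor1_zeroP.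
- exact: (acyclic_quotient ip (syz_exact A) (@acyclic_free _)).
- exact: (acyclic_tens_inj flat0 ip (syz_exact A)).
Qed.

Lemma comoduleP A : comodule u A <->
  (forall x : tensor (resr u) A, x = 0) /\ acyclic i A.
Proof. by split=> -[UA0 /acyclicP]. Qed.

Lemma tens_surj0 X Y (g : {linear X -> Y}) : (forall y, exists x, g x = y) ->
  (forall x : tensor (resr u) X, x = 0) -> forall y : tensor (resr u) Y, y = 0.
Proof.
move=> gS X0 y; have [x <-] : exists x, tens_map (lin_id _) g x = y.
  by apply: tens_map_surj => // n; exists n.
by rewrite (X0 x) linear0.
Qed.

Section Sequence.
Variables (L X N : lmodType R) (f : {linear L -> X}) (g : {linear X -> N}).
Hypothesis fg : exact_seq f g.

Lemma comodule_sub : comodule u X -> acyclic i N -> comodule u L.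
Proof.
move=> /comoduleP[X0 aX] aN; apply/comoduleP; split; last first.
  by case: fg => fI _ _; exact: (acyclic_sub flat1 fI).
move=> x; apply: (acyclic_tens_inj flat0 ip fg aN).
by rewrite linear0; exact: X0.
Qed.

Lemma comodule_quotient :
  (forall x : tensor (resr u) L, x = 0) -> comodule u X -> comodule u N.
Proof.
move=> L0 /comoduleP[X0 aX]; apply/comoduleP; split.
  by case: fg => _ gS _; exact: tens_surj0 X0.
apply: (acyclic_quotient ip fg aX) => x y _.
by rewrite (L0 x) (L0 y).
Qed.

Lemma comodule_extension : comodule u L -> comodule u N -> comodule u X.
Proof.
case: (fg) => _ gS gK /comoduleP[L0 aL] /comoduleP[N0 aN]; apply/comoduleP; split.
- move=> x; have [w <-] : exists w, tens_map (lin_id (resr u)) f w = x.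
    by apply: (tens_map_exact_r gS) (N0 _) => y /gK.
  by rewrite (L0 w) linear0.
- exact: (acyclic_extension flat0 fg aL aN).
Qed.
End Sequence.

(** A kernel of [f : X -> Y] is a subobject of [X] whose quotient embeds in
    [Y]; a cokernel is the quotient of [Y] by a quotient of [X]. *)
Lemma comodule_kernel K X Y (k : {linear K -> X}) (f : {linear X -> Y}) :
  injective k -> (forall x, f x = 0 <-> exists w, k w = x) ->
  comodule u X -> comodule u Y -> comodule u K.
Proof.
move=> kI fk X0 /comoduleP[_ aY].
have [I [g [m [gS mI mg]]]] := image_factorization f.
apply: (comodule_sub (f := k) (g := g)) => //; last exact: acyclic_sub mI aY.
split=> // x; rewrite -fk -mg; split=> [->|]; first exact: linear0.
by rewrite -(linear0 m) => /mI.
Qed.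

Lemma comodule_cokernel X Y Q (q : {linear Y -> Q}) (f : {linear X -> Y}) :
  (forall y, exists x, q x = y) -> (forall y, q y = 0 <-> exists x, f x = y) ->
  comodule u X -> comodule u Y -> comodule u Q.
Proof.
move=> qS qf /comoduleP[X0 _] Y0.
have [I [g [m [gS mI mg]]]] := image_factorization f.
apply: (comodule_quotient (f := m) (g := q)) Y0; last exact: tens_surj0 gS X0.
split=> // y; rewrite qf; split=> [[x <-]|[w <-]]; first by exists (g x).
by have [x <-] := gS w; exists x.
Qed.

Lemma comodule_kermod X Y (f : {linear X -> Y}) :
  comodule u X -> comodule u Y -> comodule u (kermod f).
Proof.
apply: (comodule_kernel (k := kincl f)); [exact: val_inj | exact: kincl_range].
Qed.

Lemma comodule_coker X Y (f : {linear X -> Y}) :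
  comodule u X -> comodule u Y -> comodule u (coker f).
Proof.
apply: (comodule_cokernel (q := coker_proj f)); first exact: coker_proj_surj.
exact: coker_proj0P.
Qed.

Lemma comodule_prod X Y : comodule u X -> comodule u Y -> comodule u (X * Y)%type.
Proof. exact: comodule_extension (prod_exact X Y). Qed.

Lemma comodule_trivial X : (forall x : X, x = 0) -> comodule u X.
Proof.
move=> X0.
have T0 (N : lmodType R^c) (z : tensor N X) : z = 0.
  move: z; apply: tensor_ind => [n m|x y -> ->]; last exact: addr0.
  by rewrite (X0 m) pure0r.
by apply/comoduleP; split=> [|x y _]; rewrite ?(T0 _ x) ?(T0 _ y).
Qed.

Lemma comodule_sum (I : eqType) (X : I -> lmodType R) (S : lmodType R)
    (inj : forall j, {linear X j -> S}) (proj : forall j, {linear S -> X j}) :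
  is_sum inj proj -> (forall j, comodule u (X j)) -> comodule u S.
Proof.
move=> sumS X0; apply/comoduleP; split; last first.
  by apply: (acyclic_sum sumS) => j; case/comoduleP: (X0 j).
apply: tensor_ind => [n m|x y -> ->]; last exact: addr0.
have [s sE] := sumS m; rewrite -(sE (undup s)) ?undup_uniq => [|//|x]; last first.
  by rewrite mem_undup.
rewrite (big_morph (pure n) (pureDr n) (pure0r _ n)) big1 // => j _.
rewrite -[n]/(lin_id _ n) -tens_mapE.
by case: (X0 j) => Xj0 _; rewrite (Xj0 (pure _ _)) linear0.
Qed.

End Comodule.

(** * Exactness in a full subcategory of modules *)

Section FullSubcategory.
Variables (R : pzRingType) (P : lmodType R -> Prop).
Implicit Types K X Y Q : lmodType R.

(** Testing only against the modules that satisfy [P] covers both the category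
    of all modules ([P] trivial) and that of comodules. *)
Definition kernel_on K X Y (k : {linear K -> X}) (f : {linear X -> Y}) : Prop :=
  lin_comp f k = 0 /\ forall W, P W -> forall h : {linear W -> X},
    lin_comp f h = 0 -> exists! h' : {linear W -> K}, lin_comp k h' = h.

Definition cokernel_on X Y Q (q : {linear Y -> Q}) (f : {linear X -> Y}) : Prop :=
  lin_comp q f = 0 /\ forall W, P W -> forall h : {linear Y -> W},
    lin_comp h f = 0 -> exists! h' : {linear Q -> W}, lin_comp h' q = h.

Lemma lin_eqP X Y (f g : {linear X -> Y}) : f = g -> f =1 g.
Proof. by move=> ->. Qed.

Hypothesis P_ker : forall X Y (f : {linear X -> Y}), P X -> P Y -> P (kermod f).
Hypothesis P_coker : forall X Y (f : {linear X -> Y}), P X -> P Y -> P (coker f).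

Lemma kincl_comp X Y (f : {linear X -> Y}) : lin_comp f (kincl f) = 0.
Proof. by apply: lin_ext => x; apply/eqP/(kvalP x). Qed.

Lemma coker_proj_comp X Y (f : {linear X -> Y}) : lin_comp (coker_proj f) f = 0.
Proof. by apply: lin_ext => x; apply/coker_proj0P; exists x. Qed.

Lemma linear_inj_ker X Y (f : {linear X -> Y}) : kincl f = 0 -> injective f.
Proof.
move=> k0; by apply: linear_inj0 => x /kincl_range[w <-]; exact: (lin_eqP k0 w).
Qed.

Lemma linear_surj_coker X Y (f : {linear X -> Y}) :
  coker_proj f = 0 -> forall y, exists x, f x = y.
Proof. by move=> q0 y; apply/coker_proj0P; exact: (lin_eqP q0 y). Qed.

(** The universal property is tested on the actual kernels of [k] and of [f],
    which satisfy [P]. *)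
Lemma kernel_onP K X Y (k : {linear K -> X}) (f : {linear X -> Y}) :
  P K -> P X -> P Y ->
  kernel_on k f <-> injective k /\ forall x, f x = 0 <-> exists w, k w = x.
Proof.
move=> PK PX PY; split=> [[fk uk]|[kI fk]].
- have fk0 w : f (k w) = 0 by exact: (lin_eqP fk w).
  split.
    apply: linear_inj_ker; have [|h [_ hU]] := uk _ (P_ker k PK PX) 0.
      by apply: lin_ext => x; exact: linear0.
    by rewrite -(hU _ (kincl_comp k)); apply: hU; apply: lin_ext => x; exact: linear0.
  move=> x; split=> [/kincl_range[w <-]|[w <-] //].
  have [h [kh _]] := uk _ (P_ker f PX PY) _ (kincl_comp f).
  by exists (h w); exact: (lin_eqP kh).
- split=> [|W _ h fh]; first by apply: lin_ext => w; apply/fk; exists w.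
  have [v|h' kh'] := linear_lift (h := h) kI; first by apply/fk/(lin_eqP fh).
  exists h'; split=> [|h'' kh'']; first exact: lin_ext.
  by apply: lin_ext => w; apply: kI; rewrite kh' -kh''.
Qed.

Lemma cokernel_onP X Y Q (q : {linear Y -> Q}) (f : {linear X -> Y}) :
  P X -> P Y -> P Q ->
  cokernel_on q f <->
  (forall z, exists y, q y = z) /\ forall y, q y = 0 <-> exists x, f x = y.
Proof.
move=> PX PY PQ; split=> [[qf uq]|[qS qf]].
- have qf0 x : q (f x) = 0 by exact: (lin_eqP qf x).
  split.
    apply: linear_surj_coker; have [|h [_ hU]] := uq _ (P_coker q PY PQ) 0.
      by apply: lin_ext => x.
    by rewrite -(hU _ (coker_proj_comp q)); apply: hU; apply: lin_ext.
  move=> y; split=> [qy|[x <-] //].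
  have [h [hq _]] := uq _ (P_coker f PX PY) _ (coker_proj_comp f).
  by apply/coker_proj0P; rewrite -(lin_eqP hq y) lin_compE qy linear0.
- split=> [|W _ h hf]; first by apply: lin_ext => x; apply/qf; exists x.
  have [v /qf[x <-]|h' hq'] := linear_descend (h := h) qS; first exact: (lin_eqP hf).
  exists h'; split=> [|h'' hq'']; first exact: lin_ext.
  by apply: lin_ext => z; have [y <-] := qS z; rewrite hq' -hq''.
Qed.
End FullSubcategory.

Section ModuleCategory.
Variable R : pzRingType.

Implicit Types K X Y Q : lmodType R.

Lemma is_kernel_modP K X Y (k : {linear K -> X}) (f : {linear X -> Y}) :
  @is_kernel (Mod R) K X Y k f <->
  injective k /\ forall x, f x = 0 <-> exists w, k w = x.
Proof.
apply: iff_trans (@kernel_onP R (fun=> True) _ K X Y k f I I I) => //.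
by split=> -[fk uk]; split=> // W h; [move=> *|]; apply: uk.
Qed.

Lemma is_cokernel_modP X Y Q (q : {linear Y -> Q}) (f : {linear X -> Y}) :
  @is_cokernel (Mod R) X Y Q q f <->
  (forall z, exists y, q y = z) /\ forall y, q y = 0 <-> exists x, f x = y.
Proof.
apply: iff_trans (@cokernel_onP R (fun=> True) _ X Y Q q f I I I) => //.
by split=> -[fk uk]; split=> // W h; [move=> *|]; apply: uk.
Qed.

(** The universal property with values in the [X j] provides the projections;
    with values in the quotient of [S] by the sum of the images of the
    injections, it shows that this quotient is zero. *)
Lemma coproduct_is_sum (J : eqType) (X : J -> lmodType R) (S : lmodType R)
    (inj : forall j, {linear X j -> S}) : @is_coproduct (Mod R) J X S inj ->
  exists proj : forall j, {linear S -> X j}, is_sum inj proj.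
Proof.
move=> cop.
pose d j l : {linear X l -> X j} :=
  if pselect (l = j) is left e then
    ecast j {linear X l -> X j} e (lin_id (X l)) else lin_zero _ _.
have dd j : d j j = lin_id (X j).
  by rewrite /d; case: pselect => // e; rewrite eq_axiomK.
have dn j l : l <> j -> d j l = lin_zero _ _ by rewrite /d; case: pselect.
have [proj projE] : exists proj : forall j, {linear S -> X j},
    forall j l x, proj j (inj l x) = d j l x.
  suff H j : {p : {linear S -> X j} | forall l x, p (inj l x) = d j l x}.
    by exists (fun j => sval (H j)) => j; exact: (svalP (H j)).
  apply: cid; have [p [pE _]] := cop _ (d j).
  by exists p => l x; rewrite -(lin_eqP (pE l) x).
exists proj.
pose T := [set x | exists j y, inj j y = x].
have spanT x : span T x.
  apply/qproj0P; have [h [_ hU]] := cop (lquot T) (fun=> 0).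
  rewrite -(lin_eqP (hU (qproj T) _) x); last first.
    by move=> j; apply: lin_ext => y; apply/qproj0P/span_mem; exists j, y.
  by rewrite (hU 0) // => j; apply: lin_ext.
move=> x; elim: (spanT x) => {x} [|_ [j [y <-]]|x y _ [s sE] _ [s' sE']|a x _ [s sE]].
- by exists [::] => t _ _; rewrite big1 // => j _; rewrite !linear0.
- exists [:: j] => t Ut jt; rewrite (bigD1_seq j) ?jt ?inE //= big1 => [|l /eqP lj].
    by rewrite addr0 projE dd.
  by rewrite projE dn ?linear0 // => /esym.
- exists (s ++ s') => t Ut st.
  rewrite -[in RHS](sE t) => [|//|j js]; last by apply: st; rewrite mem_cat js.
  rewrite -[in RHS](sE' t) => [|//|j js]; last by apply: st; rewrite mem_cat js orbT.
  by rewrite -big_split; apply: eq_bigr => j _; rewrite !linearD.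
- exists s => t Ut st; rewrite -[in RHS](sE t Ut st) scaler_sumr.
  by apply: eq_bigr => j _; rewrite !linearZ.
Qed.

End ModuleCategory.

Section ComoduleCategory.
Variables (R U : pzRingType) (u : {rmorphism R -> U}).
Variables (F1 F0 : lmodType R^c).
Variables (i : {linear F1 -> F0}) (p : {linear F0 -> resr u}).
Hypotheses (flat1 : is_flat F1) (flat0 : is_flat F0).
Hypotheses (ip : exact_seq i p).

Let C0 := @comodule_kermod R U u F1 F0 i p flat1 flat0 ip.
Let C1 := @comodule_coker R U u F1 F0 i p flat0 ip.

Lemma comodule_closed_kernels : closed_under_kernels (C := Mod R) (comodule u).
Proof.
move=> K X Y k f /is_kernel_modP[kI kf].
exact: (comodule_kernel flat1 flat0 ip kI kf).
Qed.

Lemma comodule_closed_cokernels : closed_under_cokernels (C := Mod R) (comodule u).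
Proof.
move=> X Y Q q f /is_cokernel_modP[qS qf].
exact: (comodule_cokernel flat0 ip qS qf).
Qed.

Lemma comodule_closed_extensions : closed_under_extensions (C := Mod R) (comodule u).
Proof.
move=> X Y Z f g [/is_kernel_modP[fI fg] /is_cokernel_modP[gS _]].
exact: (comodule_extension flat0 ip (And3 fI gS fg)).
Qed.

Lemma comodule_closed_coproducts : closed_under_coproducts (C := Mod R) (comodule u).
Proof.
move=> J X S inj cop X0.
have [proj sumS] := @coproduct_is_sum R {classic J} X S inj cop.
exact: (comodule_sum flat0 ip sumS X0).
Qed.

Lemma is_kernel_comodP (K X Y : Comod u) k f :
  @is_kernel (Comod u) K X Y k f <-> @is_kernel (Mod R) (sval K) (sval X) (sval Y) k f.
Proof.
apply: iff_trans (iff_sym (is_kernel_modP _ _)).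
apply: iff_trans (kernel_onP C0 k f (svalP K) (svalP X) (svalP Y)).
split=> -[fk uk]; split=> //.
- by move=> W PW h; exact: (uk (exist _ W PW) h).
- by move=> [W PW] h; exact: (uk W PW h).
Qed.

Lemma is_cokernel_comodP (X Y Q : Comod u) q f :
  @is_cokernel (Comod u) X Y Q q f <->
  @is_cokernel (Mod R) (sval X) (sval Y) (sval Q) q f.
Proof.
apply: iff_trans (iff_sym (is_cokernel_modP _ _)).
apply: iff_trans (cokernel_onP C1 q f (svalP X) (svalP Y) (svalP Q)).
split=> -[fk uk]; split=> //.
- by move=> W PW h; exact: (uk (exist _ W PW) h).
- by move=> [W PW] h; exact: (uk W PW h).
Qed.

Lemma comodule_embedding_exact : exact_functor (Comod_embedding u).
Proof.
split=> // X Y Z f g [fk gc]; split; first exact/is_kernel_comodP.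
exact/is_cokernel_comodP.
Qed.

Lemma comodule_is_abelian : is_abelian (Comod u).
Proof.
split.
- have Z0 : comodule u (kermod (lin_id (R^o : lmodType R))).
    apply: (comodule_trivial flat0 ip) => x; apply: val_inj; exact/eqP/(kvalP x).
  exists (exist _ _ Z0 : Comod u).
  by apply: lin_ext => x; apply: val_inj; exact/eqP/(kvalP x).
- move=> [X X0] [Y Y0].
  exists (exist _ _ (comodule_prod flat0 ip X0 Y0)).
  exists (lin_inl X Y), (lin_inr X Y), (lin_fst X Y), (lin_snd X Y).
  split; apply: lin_ext => // -[x y].
  by congr (_, _); rewrite /= ?addr0 ?add0r.
- move=> [X X0] [Y Y0] /= f.
  exists (exist _ _ (C0 f X0 Y0)), (kincl (f : {linear X -> Y})).
  apply/is_kernel_comodP/is_kernel_modP.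
  by split=> [|x]; [exact: val_inj | exact: kincl_range].
- move=> [X X0] [Y Y0] /= f.
  exists (exist _ _ (C1 f X0 Y0)), (coker_proj (f : {linear X -> Y})).
  apply/is_cokernel_comodP/is_cokernel_modP.
  by split; [exact: coker_proj_surj | exact: coker_proj0P].
- move=> [X X0] [Y Y0] /= f fm.
  exists (exist _ _ (C1 f X0 Y0)), (coker_proj (f : {linear X -> Y})).
  apply/is_kernel_comodP/is_kernel_modP; split; last exact: coker_proj0P.
  apply: linear_inj_ker; apply: (fm (exist _ _ (C0 f X0 Y0))).
  rewrite [LHS]kincl_comp; apply: lin_ext => x.
  exact/esym/(linear0 (f : {linear X -> Y})).
- move=> [X X0] [Y Y0] /= f fe.
  exists (exist _ _ (C0 f X0 Y0)), (kincl (f : {linear X -> Y})).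
  apply/is_cokernel_comodP/is_cokernel_modP; split; last exact: kincl_range.
  apply: linear_surj_coker; apply: (fe (exist _ _ (C1 f X0 Y0))).
  by rewrite [LHS]coker_proj_comp; apply: lin_ext.
Qed.

End ComoduleCategory.

(** * Extension of scalars along a ring epimorphism *)

Section EndomorphismRing.
Variable G : lmodType int.

(** Target ring for testing the epimorphism property. *)
Definition endring : Type := {linear G -> G}.
HB.instance Definition _ := GRing.Zmodule.copy endring {linear G -> G}.

Definition end_mul (f g : endring) : endring := lin_comp f g.
Fact end_mulA : associative end_mul. Proof. by move=> f g h; exact: lin_ext. Qed.
Fact end_mul1l : left_id (lin_id G : endring) end_mul.
Proof. by move=> f; exact: lin_ext. Qed.
Fact end_mul1r : right_id (lin_id G : endring) end_mul.
Proof. by move=> f; exact: lin_ext. Qed.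
Fact end_mulDl : left_distributive end_mul +%R.
Proof. by move=> f g h; exact: lin_ext. Qed.
Fact end_mulDr : right_distributive end_mul +%R.
Proof. by move=> f g h; apply: lin_ext => x; exact: (linearD f). Qed.
HB.instance Definition _ := GRing.Zmodule_isPzRing.Build endring
  end_mulA end_mul1l end_mul1r end_mulDl end_mulDr.
End EndomorphismRing.

(** Conjugating [f] by a unit [c] that commutes with the image of [R] gives a
    second ring morphism on [U] that agrees with [f] on [R], hence is [f]. *)
Lemma ring_epi_commute (R U : pzRingType) (u : {rmorphism R -> U}) (V : pzRingType)
    (f : {rmorphism U -> V}) (c d : V) : ring_epi u -> c * d = 1 -> d * c = 1 ->
  (forall r, c * f (u r) = f (u r) * c) -> forall x, c * f x = f x * c.
Proof.
move=> epi cd dc cu.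
pose g (x : U) : V := c * f x * d.
have gB : {morph g : x y / x - y} by move=> x y; rewrite /g rmorphB mulrBr mulrBl.
have gM : monoid_morphism g.
  split=> [|x y]; first by rewrite /g rmorph1 mulr1.
  by rewrite /g rmorphM !mulrA -[c * f x * d * c]mulrA dc mulr1.
pose G : {rmorphism U -> V} := HB.pack g (GRing.isZmodMorphism.Build U V g gB)
  (GRing.isMonoidMorphism.Build U V g gM).
have gf x : g x = f x.
  apply: (epi V G f) => r /=.
  by rewrite -[LHS]/(g (u r)) /g cu -mulrA cd mulr1.
by move=> x; rewrite -{2}gf /g -mulrA dc mulr1.
Qed.

Section ExtensionOfScalars.
Variables (R U : pzRingType) (u : {rmorphism R -> U}).
Implicit Types A L N X Y Z : lmodType R.

Local Notation B := (ring_bimod u).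

Definition extend X : lmodType R := btensor B X.
Definition extend_map X Y (f : {linear X -> Y}) : {linear extend X -> extend Y} :=
  btens_map (bimod_id B) f.

Fact umul_linear (a : U) : linear (fun x : resr u => a * (x : U) : resr u).
Proof. by move=> r x y; rewrite [LHS]mulrDr; congr (_ + _); exact: mulrA. Qed.
Definition umul a := mklin (umul_linear a).

Definition uact X (a : U) : {linear tensor (resr u) X -> tensor (resr u) X} :=
  tens_map (umul a) (lin_id X).

Lemma uactE X a (b : resr u) (x : X) :
  uact X a (pure b x) = pure (a * (b : U) : resr u) x.
Proof. exact: tens_mapE. Qed.

Lemma uactD X a b y : uact X (a + b) y = uact X a y + uact X b y.
Proof.
move: y; apply: (tensor_ext (g := lin_add (uact X a) (uact X b))) => n m.
by rewrite lin_addE !uactE -pureDl; congr pure; exact: mulrDl.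
Qed.
Lemma uactM X a b y : uact X (a * b) y = uact X a (uact X b y).
Proof.
move: y; apply: (tensor_ext (g := lin_comp (uact X a) (uact X b))) => n m.
by rewrite lin_compE !uactE mulrA.
Qed.
Lemma uact1 X y : uact X 1 y = y.
Proof.
move: y; apply: (tensor_ext (g := lin_id _)) => n m.
by rewrite uactE mul1r.
Qed.
Lemma uact_scale X r (y : extend X) : uact X (u r) y = r *: y.
Proof. by move: y; apply: tensor_ext => n m; rewrite uactE tens_mapE. Qed.

Fact unit_linear X : linear (fun x : X => pure (1 : resr u) x : extend X).
Proof.
move=> r x y; rewrite [LHS]pureDr; congr (_ + _).
rewrite [RHS]tens_mapE -pureZ; congr pure.
by transitivity (u r); [exact: mul1r | exact/esym/mulr1].
Qed.
Definition extend_unit X : {linear X -> extend X} := mklin (@unit_linear X).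

Section Counit.
Variable X : lmodType R.

Let b (a : resr u) (y : extend X) : tensor (resr u) X := uact X a y.
Fact counit_bDl a a' y : b (a + a') y = b a y + b a' y. Proof. exact: uactD. Qed.
Fact counit_bDr a y y' : b a (y + y') = b a y + b a y'. Proof. exact: linearD. Qed.
Fact counit_bZ a (r : R) y : b ((r : R^c) *: a) y = b a (r *: y).
Proof. by rewrite /b -uact_scale -uactM. Qed.
Let counit_int := tens_lift counit_bDl counit_bDr counit_bZ.

Fact counit_linear : linear (counit_int : extend (extend X) -> extend X).
Proof.
move=> r y y'; rewrite [LHS]linearD; congr (_ + _).
rewrite -!uact_scale; move: y {y'}.
apply: (tensor_ext (f := lin_comp counit_int (uact _ (u r)))
  (g := lin_comp (uact _ (u r)) counit_int)) => a y.
by rewrite !lin_compE uactE !tens_liftE /b uactM.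
Qed.
Definition counit : {linear extend (extend X) -> extend X} := mklin counit_linear.

Lemma counitE (a : resr u) (y : extend X) : counit (pure a y) = uact X a y.
Proof. exact: tens_liftE. Qed.

Lemma counit_unit y : counit (extend_unit _ y) = y.
Proof. by rewrite [LHS]counitE uact1. Qed.

Lemma counit_extend_unit y : counit (extend_map (extend_unit X) y) = y.
Proof.
move: y; apply: (tensor_ext (f := lin_comp (tens_lift counit_bDl counit_bDr counit_bZ)
  (tens_map (lin_id (resr u)) (extend_unit X))) (g := lin_id _)) => a x.
rewrite lin_compE; transitivity (counit (pure a (extend_unit X x : extend X))).
  exact: (congr1 counit (tens_mapE (lin_id (resr u)) (extend_unit X) a x)).
rewrite counitE; transitivity (pure (a * 1 : resr u) x); first exact: uactE.
by congr pure; exact: mulr1.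
Qed.

(** Put [Y = U (x) X].  The automorphism [(y, z) |-> (y, z + 1 (x) y)] of the
    abelian group [Y x (U (x) Y)] commutes with the action of [R], hence with that
    of [U] by [ring_epi_commute]: this says [a (x) y = 1 (x) a y]. *)
Lemma epi_pure (epi : ring_epi u) (a : resr u) (y : extend X) :
  pure a y = pure (1 : resr u) (uact X a y : extend X).
Proof.
pose Y := tensor (resr u) X; pose Z := tensor (resr u) (extend X).
pose f_fun (a : U) (w : Y * Z) : Y * Z := (uact X a w.1, uact (extend X) a w.2).
have fl a' : linear (f_fun a').
  apply: int_linear => w w'; congr (_, _); exact: linearD.
pose f' a' : endring (Y * Z)%type := mklin (fl a').
have fB : {morph f' : x y / x - y}.
  have fD : {morph f' : x y / x + y}.
    by move=> x x'; apply: lin_ext => w; apply: injective_projections; exact: uactD.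
  by move=> x x'; apply: (addIr (f' x')); rewrite -fD !subrK.
have fM : monoid_morphism f'.
  split=> [|x x']; apply: lin_ext => w; apply: injective_projections.
  - exact: (uact1 w.1).
  - exact: (uact1 w.2).
  - exact: (uactM x x' w.1).
  - exact: (uactM x x' w.2).
pose f : {rmorphism U -> endring (Y * Z)%type} :=
  HB.pack f' (GRing.isZmodMorphism.Build U (endring (Y * Z)%type) f' fB)
  (GRing.isMonoidMorphism.Build U (endring (Y * Z)%type) f' fM).
pose un (w : Y) : Z := pure (1 : resr u) (w : extend X).
have unD w w' : un (w + w') = un w + un w' by exact: pureDr.
pose shift (s : int) (w : Y * Z) : Y * Z := (w.1, w.2 + s *: un w.1).
have sl s : linear (shift s).
  apply: int_linear => w w'; congr (_, _).
  by rewrite /= unD scalerDr addrACA.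
pose c s : endring (Y * Z)%type := mklin (sl s).
have cc s : c s * c (- s) = 1.
  apply: lin_ext => w; apply: injective_projections => //=.
  by rewrite scaleNr subrK.
have cf r : c 1 * f (u r) = f (u r) * c 1.
  apply: lin_ext => w; apply: injective_projections; first by [].
  change (uact (extend X) (u r) w.2 + 1%:Z *: un (uact X (u r) w.1) =
    uact (extend X) (u r) (w.2 + 1%:Z *: un w.1)).
  rewrite [RHS]linearD !scale1r; congr (_ + _).
  rewrite [RHS]uactE; transitivity (pure (1 : resr u) (r *: (w.1 : extend X))).
    by congr pure; exact: uact_scale.
  rewrite -pureZ; congr pure.
  by transitivity (u r); [exact: mul1r | exact/esym/mulr1].
have := lin_eqP (ring_epi_commute epi (cc 1) (cc (-1)) cf a) (y, 0).
move=> /(congr1 snd) E.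
have {E} : uact (extend X) a 0 + 1%:Z *: un (uact X a y) =
  uact (extend X) a (0 + 1%:Z *: un y) := E.
rewrite add0r !scale1r linear0 add0r => E.
rewrite -[RHS]/(un _) E [RHS]uactE; congr pure; exact/esym/mulr1.
Qed.
End Counit.

Lemma unit_extend_inj X : injective (extend_unit (extend X)).
Proof. exact: can_inj (@counit_unit X). Qed.

Lemma unit_extend_surj (epi : ring_epi u) X (z : extend (extend X)) :
  exists y, extend_unit (extend X) y = z.
Proof.
move: z; apply: tensor_ind => [a y|_ _ [y <-] [y' <-]].
  by exists (uact X a y); exact/esym/epi_pure.
by exists (y + y'); exact: linearD.
Qed.

Lemma extend_map_unit X Y (f : {linear X -> Y}) x :
  extend_map f (extend_unit X x) = extend_unit Y (f x).
Proof. exact: tens_mapE. Qed.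

(** The unit, which is bijective on [U (x) X] and [U (x) Y], identifies [f] with
    [U (x) f]. *)
Lemma extend_map_extend_inj (epi : ring_epi u) X Y (f : {linear extend X -> extend Y}) :
  injective f -> injective (extend_map f).
Proof.
move=> fI; apply: linear_inj0 => z.
have [y <-] := unit_extend_surj epi z.
rewrite extend_map_unit -(linear0 (extend_unit _)).
by move=> /unit_extend_inj; rewrite -(linear0 f) => /fI ->; rewrite linear0.
Qed.

Section FreeModule.
Variable S : choiceType.

Fact extend_inj_linear (s : S) :
  linear (fun a : resl u => pure (a : resr u) (fbase s) : extend (freemod R S)).
Proof.
move=> r a a'; rewrite [LHS]pureDl; congr (_ + _).
exact/esym/tens_mapE.
Qed.
Definition extend_inj s : {linear resl u -> extend (freemod R S)} :=
  mklin (extend_inj_linear s).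

Let b s (a : resr u) (q : freemod R S) : zmodule (resl u) := (a : U) * u (q s).
Fact extend_proj_bDl s a a' q : b s (a + a') q = b s a q + b s a' q.
Proof. exact: mulrDl. Qed.
Fact extend_proj_bDr s a q q' : b s a (q + q') = b s a q + b s a q'.
Proof. by rewrite /b [u _](rmorphD u); exact: mulrDr. Qed.
Fact extend_proj_bZ s a (r : R) q : b s ((r : R^c) *: a) q = b s a (r *: q).
Proof. by rewrite /b [u ((r *: q) s)](rmorphM u) mulrA. Qed.
Let proj_int s := tens_lift (extend_proj_bDl s) (extend_proj_bDr s) (extend_proj_bZ s).

Fact extend_proj_linear s : linear (proj_int s : extend (freemod R S) -> resl u).
Proof.
move=> r y y'; rewrite [LHS]linearD; congr (_ + _).
rewrite -uact_scale; move: y {y'}.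
apply: (tensor_ind (P := fun y =>
    proj_int s (uact _ (u r) y) = u r * (proj_int s y : U) :> U)).
  by move=> a q; rewrite uactE !tens_liftE /b mulrA.
by move=> y y' Ey Ey'; rewrite !linearD Ey Ey'; exact/esym/mulrDr.
Qed.
Definition extend_proj s : {linear extend (freemod R S) -> resl u} :=
  mklin (extend_proj_linear s).

Lemma extend_projE s (a : resr u) q : extend_proj s (pure a q) = (a : U) * u (q s).
Proof.
exact: (tens_liftE (extend_proj_bDl s) (extend_proj_bDr s) (extend_proj_bZ s) a q).
Qed.

Lemma extend_free_is_sum : is_sum extend_inj extend_proj.
Proof.
apply: tensor_ind => [a q|x y [s sE] [s' sE']].
- have [s sE] := free_is_sum q; exists s => t Ut st.
  rewrite -[in RHS](sE t Ut st) (big_morph (pure a) (pureDr a) (pure0r _ a)).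
  apply: eq_bigr => j _; rewrite extend_projE.
  by rewrite -[RHS]pureZ; congr pure.
- exists (s ++ s') => t Ut st.
  rewrite -[in RHS](sE t) => [|//|j js]; last by apply: st; rewrite mem_cat js.
  rewrite -[in RHS](sE' t) => [|//|j js]; last by apply: st; rewrite mem_cat js orbT.
  by rewrite -[RHS]big_split; apply: eq_bigr => j _; rewrite !linearD.
Qed.
End FreeModule.

Section Acyclicity.
Hypothesis epi : ring_epi u.
Variables (F1 F0 : lmodType R^c).
Variables (i : {linear F1 -> F0}) (p : {linear F0 -> resr u}).
Hypotheses (flat1 : is_flat F1) (flat0 : is_flat F0).
Hypotheses (ip : exact_seq i p).
Hypothesis aU : acyclic i (resl u).

Lemma acyclic_extend_free S : acyclic i (extend (freemod R S)).
Proof. exact: (acyclic_sum (@extend_free_is_sum S)). Qed.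

Lemma acyclic_syz A : acyclic i (syz A).
Proof.
apply: (acyclic_sub flat1 (f := kincl (aug A))); first exact: val_inj.
exact: (acyclic_free ip).
Qed.

Lemma extend_exact L X N (f : {linear L -> X}) (g : {linear X -> N}) :
  acyclic i N -> exact_seq f g -> exact_seq (extend_map f) (extend_map g).
Proof.
move=> aN fg; case: (fg) => fI gS gf; split.
- exact: (acyclic_tens_inj flat0 ip fg aN).
- by apply: tens_map_surj => // n; exists n.
- move=> x; split; first by apply: tens_map_exact_r => // y /gf.
  case=> w <-; rewrite [LHS]tens_map_comp; apply: tens_map_zero => y.
  by apply/gf; exists y.
Qed.

(** [0 -> U (x) Z' -> U (x) P -> U (x) Z -> 0] is exact for a free cover
    [P -> Z] with kernel [Z'], and [U (x) -] does not change its first map. *)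
Lemma acyclic_extend Z : acyclic i Z -> acyclic i (extend Z).
Proof.
move=> aZ; have ex := extend_exact aZ (syz_exact Z).
apply: (acyclic_quotient ip ex); first exact: acyclic_extend_free.
by apply: (extend_map_extend_inj epi); case: ex.
Qed.
End Acyclicity.

End ExtensionOfScalars.
Arguments extend_map : simpl never.
Arguments extend_unit : simpl never.

(** * Gamma as a kernel *)

Section LeftUnit.
Variables (R : pzRingType) (P : lmodType R).
Local Notation B0 := (ring_bimod (idfun : {rmorphism R -> R})).

Local Notation R0 := (resr (idfun : {rmorphism R -> R})).

Let b (r : R0) (x : P) : zmodule P := (r : R) *: x.
Fact lunit_bDl r r' x : b (r + r') x = b r x + b r' x.
Proof. exact: (@scalerDl _ P). Qed.
Fact lunit_bDr r x x' : b r (x + x') = b r x + b r x'.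
Proof. exact: (@scalerDr _ P). Qed.
Fact lunit_bZ r (s : R) x : b ((s : R^c) *: r) x = b r (s *: x).
Proof. by rewrite /b scalerA. Qed.
Let lunit_int := tens_lift lunit_bDl lunit_bDr lunit_bZ.

Fact lunit_linear : linear (lunit_int : btensor B0 P -> P).
Proof.
move=> r y y'; rewrite [LHS]linearD; congr (_ + _); move: y {y'}.
apply: (tensor_ind (P := fun y : btensor B0 P =>
    lunit_int (r *: y) = r *: (lunit_int y : P) :> P)).
  move=> s x; rewrite tens_liftE /b scalerA.
  rewrite [r *: _](_ : _ = pure (r * (s : R) : R0) x).
    exact: (tens_liftE lunit_bDl lunit_bDr lunit_bZ).
  exact: tens_mapE.
by move=> y y' Ey Ey'; rewrite scalerDr !linearD Ey Ey' scalerDr.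
Qed.
Definition lunit : {linear btensor B0 P -> P} := mklin lunit_linear.

Lemma lunitE (r : R) x : lunit (pure (r : R0) x) = r *: x.
Proof. exact: (tens_liftE lunit_bDl lunit_bDr lunit_bZ). Qed.

Lemma lunit_surj x : exists y, lunit y = x.
Proof. by exists (pure (1 : R0) x); rewrite lunitE scale1r. Qed.

Lemma lunit_inj : injective lunit.
Proof.
have E y : y = pure (1 : R0) (lunit y).
  move: y; apply: tensor_ind => [r x|y y' Ey Ey'].
    by rewrite lunitE -pureZ; congr pure; exact/esym/mul1r.
  by rewrite [lunit _]linearD pureDr -Ey -Ey'.
by move=> y y' yy'; rewrite (E y) (E y') yy'.
Qed.
End LeftUnit.

Lemma lunit_nat (R : pzRingType) (P Q : lmodType R) (f : {linear P -> Q}) y :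
  lunit Q (btens_map (bimod_id _) f y) = f (lunit P y).
Proof.
move: y; apply: tensor_ind => [r x|y y' Ey Ey'].
  rewrite lunitE linearZ.
  rewrite [btens_map _ _ _](_ : _ = pure (r : resr (idfun : {rmorphism R -> R})) (f x)).
    exact: lunitE.
  exact: tens_mapE.
by rewrite !linearD Ey Ey'.
Qed.

Section GammaKernel.
Variables (R U : pzRingType) (u : {rmorphism R -> U}).
Variable A : lmodType R.

Local Notation P := (res 0 A).
Local Notation Z := (syz A).
Local Notation inc := (kincl (aug A)).
Local Notation C := (P * extend u Z)%type.

Fact middle_rel_linear : linear (fun z : Z => (- inc z, extend_unit u Z z) : C).
Proof. by move=> a x y; congr (_, _); rewrite linearP // opprD -scalerN. Qed.

(** The pushout of [Z -> P] and [Z -> U (x) Z], which mediates between [A] and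
    [Gamma u A]: it maps onto [A] with kernel [U (x) Z], and contains
    [Gamma u A] as the kernel of a map to [U (x) P]. *)
Definition middle : lmodType R := coker (mklin middle_rel_linear).

Local Notation mk := (coker_proj (mklin middle_rel_linear)).

Fact to_extend_linear :
  linear (fun x : C => extend_unit u P x.1 + extend_map u inc x.2).
Proof. by move=> a x y; rewrite pairP1 pairP2 !linearP scalerDr addrACA. Qed.
Fact to_extend_rel z : mklin to_extend_linear (mklin middle_rel_linear z) = 0.
Proof.
rewrite -[LHS]/(extend_unit u P (- inc z) + extend_map u inc (extend_unit u Z z)).
by rewrite linearN extend_map_unit addNr.
Qed.
Definition to_extend : {linear middle -> extend u P} := coker_lift to_extend_rel.

Lemma to_extendE x : to_extend (mk x) = extend_unit u P x.1 + extend_map u inc x.2.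
Proof. exact: (coker_liftE to_extend_rel). Qed.

Fact to_base_linear : linear (fun x : C => aug A x.1).
Proof. by move=> a x y; rewrite pairP1 linearP. Qed.
Fact to_base_rel z : mklin to_base_linear (mklin middle_rel_linear z) = 0.
Proof.
rewrite -[LHS]/(aug A (- inc z)) linearN.
by apply/eqP; rewrite oppr_eq0; exact: (kvalP z).
Qed.
Definition to_base : {linear middle -> A} := coker_lift to_base_rel.

Lemma to_baseE x : to_base (mk x) = aug A x.1.
Proof. exact: (coker_liftE to_base_rel). Qed.

Definition from_extend : {linear extend u Z -> middle} :=
  lin_comp mk (lin_inr P (extend u Z)).

Lemma middle_exact : exact_seq from_extend to_base.
Proof.
split.
- apply: linear_inj0 => t /coker_proj0P[z E].
  have z0 : - inc z = 0 := congr1 fst E.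
  have <- : extend_unit u Z z = t := congr1 snd E.
  rewrite (_ : z = 0) ?linear0 //; apply: val_inj.
  by apply/eqP; rewrite -oppr_eq0; exact/eqP.
- by move=> a; have [x xa] := aug_surj a; exists (mk (x, 0)); rewrite to_baseE.
- move=> y; have [[x t] <-] := coker_proj_surj y.
  split=> [|[t' <-]]; last by rewrite to_baseE; exact: linear0.
  rewrite to_baseE => ax.
  have kx : x \in in_ker (aug A) by apply/eqP.
  (* In the pushout [(x, t) = (0, t + 1 (x) x)], as [x] comes from [Z]. *)
  exists (t + extend_unit u Z (Kermod kx)); apply/eqP.
  rewrite -[from_extend _]/(mk (0, _)) -subr_eq0 -(linearB mk).
  apply/eqP/coker_proj0P; exists (Kermod kx).
  by apply: injective_projections; rewrite /= ?sub0r // addrC addKr.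
Qed.

Local Notation K := (Kdiff u).

Lemma Kdiff_tens (Q : lmodType R) y :
  btens_map K (lin_id Q) y = extend_unit u Q (lunit Q y).
Proof.
move: y; apply: tensor_ind => [r x|y y' Ey Ey']; last by rewrite !linearD Ey Ey'.
rewrite lunitE; transitivity (pure (u r : resr u) x); first exact: tens_mapE.
transitivity (pure (1 : resr u) ((r : R) *: x)); last by [].
by rewrite -pureZ; congr pure; exact/esym/mul1r.
Qed.

Lemma extend_res_d y :
  btens_map (bimod_id (ring_bimod u)) (res_d 0 A) y =
  extend_map u inc (extend_map u (aug Z) y).
Proof.
rewrite [RHS]tens_map_comp; move: y; apply: tensor_ext => n m.
by rewrite !tens_mapE.
Qed.

(** A cycle of the total complex has components in [R (x) P] and [U (x) P'],
    where [P'] is the free cover of [Z].  Modulo the boundaries that come from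
    [U (x) res 2 A] the second one matters only through its image in [U (x) Z]. *)
Definition tot1_to_pair_fun (x : tot1 (ring_bimod idfun) (ring_bimod u) A) : C :=
  (lunit _ x.1, extend_map u (aug Z) x.2).
Fact tot1_to_pair_linear : linear tot1_to_pair_fun.
Proof. by move=> a x y; rewrite /tot1_to_pair_fun pairP1 pairP2 !linearP. Qed.
Definition tot1_to_pair := mklin tot1_to_pair_linear.

Lemma tot1_to_pairE x :
  tot1_to_pair x = (lunit _ x.1, extend_map u (aug Z) x.2).
Proof. by []. Qed.

Let cycle_to_middle := lin_comp mk (lin_comp tot1_to_pair (kincl (tot_d1 K A))).

Fact Gamma_to_middle_rel (w : kermod (tot_d1 K A)) :
  (exists y, kval w = tot_d2 K A y) -> cycle_to_middle w = 0.
Proof.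
case=> -[a b] wE; rewrite /cycle_to_middle !lin_compE.
apply/coker_proj0P; exists (aug Z (lunit _ a)).
rewrite -[kincl _ w]/(kval w) wE tot_d2E tot1_to_pairE; apply: injective_projections.
- by rewrite [RHS]linearN; congr (- _); exact/esym/lunit_nat.
- apply: esym; rewrite [LHS]linearD.
  rewrite [X in _ + X](_ : _ = 0); last first.
    rewrite [LHS]tens_map_comp; apply: tens_map_zero => m.
    exact/eqP/(kvalP (aug (syzn 2 A) m)).
  by rewrite addr0 Kdiff_tens; exact: extend_map_unit.
Qed.
Definition Gamma_to_middle : {linear Gamma u A -> middle} := qlift Gamma_to_middle_rel.

Lemma Gamma_to_middleE (w : kermod (tot_d1 K A)) :
  Gamma_to_middle (qproj _ w) =
  mk (lunit _ (kval w).1, extend_map u (aug Z) (kval w).2).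
Proof. exact: (qliftE Gamma_to_middle_rel). Qed.

Lemma Gamma_to_middle_inj : injective Gamma_to_middle.
Proof.
apply: linear_inj0 => g; rewrite -[g]qreprK; move: (qrepr g) => w {g}.
rewrite Gamma_to_middleE => /coker_proj0P[z E]; apply/qproj0P/span_mem.
have z1 : - inc z = lunit _ (kval w).1 := congr1 fst E.
have z2 : extend_unit u Z z = extend_map u (aug Z) (kval w).2 := congr1 snd E.
have [x xz] := aug_surj z; have [a ax] := lunit_surj x.
have [b bw] : exists b, btens_map (bimod_id (ring_bimod u)) (res_d 1 A) b =
    (kval w).2 - btens_map K (lin_id _) a.
  apply: tens_aug_ker; rewrite -[LHS]/(extend_map u (aug Z) _) linearB -z2.
  by rewrite Kdiff_tens extend_map_unit ax xz subrr.
exists (a, b); rewrite tot_d2E [LHS]surjective_pairing; congr (_, _).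
- apply: (@lunit_inj R P); rewrite -z1 linearN; congr (- _).
  by rewrite [RHS]lunit_nat ax -xz.
- by rewrite bw addrC subrK.
Qed.

Lemma Gamma_middle_ker y : to_extend y = 0 <-> exists g, Gamma_to_middle g = y.
Proof.
split=> [|[g <-]].
- have [[x t] <-] := coker_proj_surj y; rewrite to_extendE => xt.
  have [a ax] := lunit_surj x.
  have [b bt] : exists b, extend_map u (aug Z) b = t.
    by apply: tens_map_surj; [move=> n; exists n|exact: aug_surj].
  have kab : (a, b) \in in_ker (tot_d1 K A).
    by apply/eqP; rewrite tot_d1E Kdiff_tens extend_res_d bt ax.
  by exists (qproj _ (Kermod kab)); rewrite Gamma_to_middleE -ax -bt.
- rewrite -[g]qreprK; move: (qrepr g) => w {g}.
  rewrite Gamma_to_middleE to_extendE.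
  have /eqP := kvalP w; rewrite tot_d1E => <-.
  by rewrite Kdiff_tens extend_res_d.
Qed.

End GammaKernel.

(** * Maps from comodules and the coreflection *)

Section MapsFromComodules.
Variables (R U : pzRingType) (u : {rmorphism R -> U}).
Implicit Types A M X Y : lmodType R.

(** A map from [M] to [U (x) X] factors through [U (x) M]. *)
Lemma hom_extend_zero M X (h : {linear M -> extend u X}) :
  (forall x : tensor (resr u) M, x = 0) -> forall m, h m = 0.
Proof.
move=> M0 m; rewrite -(counit_unit (h m)) -extend_map_unit.
by rewrite (M0 (extend_unit u M m)) !linear0.
Qed.

Variables (F1 F0 : lmodType R^c).
Variables (i : {linear F1 -> F0}) (p : {linear F0 -> resr u}).
Hypotheses (flat1 : is_flat F1) (flat0 : is_flat F0).
Hypotheses (ip : exact_seq i p).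

(** [Ext^1(M, U (x) Y) = 0] for a comodule [M]: applying [U (x) -] to the
    extension makes its first map invertible, and the inverse followed by the
    counit is a retraction. *)
Lemma extension_retraction M X Y (f : {linear extend u Y -> X}) (g : {linear X -> M}) :
  exact_seq f g -> comodule u M ->
  exists r : {linear X -> extend u Y}, forall y, r (f y) = y.
Proof.
move=> fg /(comoduleP flat0 ip)[M0 aM].
have fI := acyclic_tens_inj flat0 ip fg aM.
have [|h hE] := linear_lift (k := extend_map u f) (h := extend_unit u X) fI.
  case: fg => _ gS gf x.
  by apply: (tens_map_exact_r gS) (M0 _) => y /gf.
exists (lin_comp (counit u Y) h) => y; rewrite lin_compE.
rewrite (_ : h (f y) = extend_unit u _ y) ?counit_unit //.
by apply: fI; rewrite [LHS]hE [RHS]extend_map_unit.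
Qed.

(** The pullback of the extension along [h] is split by its retraction, and
    two lifts differ by a map to [U (x) Y], which is zero. *)
Lemma comodule_lift M A X Y (f : {linear extend u Y -> X}) (g : {linear X -> A})
    (h : {linear M -> A}) : exact_seq f g -> comodule u M ->
  exists h' : {linear M -> X}, (forall m, g (h' m) = h m) /\
    forall h'' : {linear M -> X}, (forall m, g (h'' m) = h m) -> h' =1 h''.
Proof.
move=> [fI gS gf] M0.
pose D := lin_add (lin_comp h (lin_fst M X)) (lin_opp (lin_comp g (lin_snd M X))).
have DE (w : kermod D) : h (kval w).1 = g (kval w).2.
  by apply/eqP; rewrite -subr_eq0; exact: (kvalP w).
have kI : injective (kincl D) by exact: val_inj.
have [|j jE] := linear_lift (h := lin_comp (lin_inr M X) f) kI.
  move=> y; have ky : (0, f y) \in in_ker D.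
    by apply/eqP; rewrite /= linear0 (_ : g (f y) = 0) ?subrr //; apply/gf; exists y.
  by exists (Kermod ky).
pose q := lin_comp (lin_fst M X) (kincl D).
have jq : exact_seq j q.
  split.
  + by move=> y y' /(congr1 (kincl D)); rewrite !jE => /(congr1 snd)/fI.
  + move=> m; have [x xm] := gS (h m).
    have kx : (m, x) \in in_ker D by apply/eqP; rewrite /= xm subrr.
    by exists (Kermod kx).
  + move=> w; split=> [w0|[y <-]]; last by rewrite lin_compE jE.
    have /gf[y yw] : g (kval w).2 = 0 by rewrite -DE [(kval w).1]w0 linear0.
    exists y; apply: val_inj; apply: (etrans (jE y)); apply: injective_projections.
      exact: (esym w0).
    exact: yw.
have [r rj] := extension_retraction jq M0.
pose s0 := lin_add (lin_comp (lin_snd M X) (kincl D)) (lin_opp (lin_comp f r)).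
have qS : forall m, exists w, q w = m by case: jq.
have [w|s sE] := linear_descend (q := q) (h := s0) qS.
  case: jq => _ _ jq /jq[y <-]; rewrite /s0 lin_addE lin_compE jE.
  by rewrite -[lin_opp _ _]/(- f (r (j y))) rj; exact: subrr.
exists s; split=> [m|h'' h''E m].
- have [w <-] := qS m; rewrite sE.
  rewrite -[s0 w]/((kval w).2 - f (r w)) linearB -DE (_ : g _ = 0) ?subr0 //.
  by apply/gf; exists (r w).
- have [|d dE] := linear_lift (h := lin_add s (lin_opp h'')) fI.
    move=> x; apply/gf; rewrite lin_addE linearD.
    rewrite -[lin_opp _ _]/(- h'' x) linearN h''E.
    have [w wx] := qS x; rewrite -wx sE.
    rewrite -[s0 w]/((kval w).2 - f (r w)) linearB -DE.
    rewrite (_ : g (f _) = 0) ?subr0 ?subrr //.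
    by apply/gf; exists (r w).
  apply/eqP; rewrite -subr_eq0 -[_ - _]/(lin_add s (lin_opp h'') m) -dE.
  case: M0 => M0 _; by rewrite (hom_extend_zero d M0) linear0.
Qed.
End MapsFromComodules.

Section Coreflection.
Variables (R U : pzRingType) (u : {rmorphism R -> U}).
Implicit Types A B M : lmodType R.

Definition Gamma_counit A : {linear Gamma u A -> A} :=
  lin_comp (to_base u A) (Gamma_to_middle u A).

Lemma Gamma_counitE A (w : kermod (tot_d1 (Kdiff u) A)) :
  Gamma_counit A (qproj _ w) = aug A (lunit _ (kval w).1).
Proof. by rewrite lin_compE Gamma_to_middleE to_baseE. Qed.

Lemma Gamma_counit_nat A B (f : {linear A -> B}) z :
  Gamma_counit B (Gamma_map u f z) = f (Gamma_counit A z).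
Proof.
rewrite -[z]qreprK; move: (qrepr z) => w {z}.
rewrite [Gamma_map u f _]hyperTor1_mapE !Gamma_counitE.
rewrite -[LHS]/(aug B (lunit _ (btens_map (bimod_id _) (res_map 0 f) (kval w).1))).
by rewrite lunit_nat; exact: aug_nat.
Qed.

Variables (F1 F0 : lmodType R^c).
Variables (i : {linear F1 -> F0}) (p : {linear F0 -> resr u}).
Hypotheses (flat1 : is_flat F1) (flat0 : is_flat F0).
Hypotheses (ip : exact_seq i p).

Lemma Gamma_universal A M (f : {linear M -> A}) : comodule u M ->
  exists g : {linear M -> Gamma u A}, (forall m, Gamma_counit A (g m) = f m) /\
    forall g' : {linear M -> Gamma u A},
      (forall m, Gamma_counit A (g' m) = f m) -> g = g'.
Proof.
move=> M0; have [h [hE hU]] := comodule_lift flat0 ip f (middle_exact u A) M0.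
have [|g gE] := linear_lift (h := h) (@Gamma_to_middle_inj R U u A).
  move=> m; apply/Gamma_middle_ker; case: M0 => M0 _.
  exact: (hom_extend_zero (lin_comp (to_extend u A) h) M0).
exists g; split=> [m|g' g'E]; first by rewrite lin_compE gE.
apply: lin_ext => m.
apply: (@Gamma_to_middle_inj R U u A); rewrite gE.
by apply: (hU (lin_comp (Gamma_to_middle u A) g')) => {}m; rewrite -g'E.
Qed.

Hypothesis epi : ring_epi u.
Hypothesis aU : acyclic i (resl u).

(** Both maps are inverse to the counit. *)
Lemma extend_map_unitE A : extend_map u (extend_unit u A) =1 extend_unit u (extend u A).
Proof.
move=> y; have [y' yy'] := unit_extend_surj epi (extend_map u (extend_unit u A) y).
by rewrite -yy' -(counit_unit y') yy' counit_extend_unit.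
Qed.

Section Middle.
Variable A : lmodType R.
Local Notation P := (res 0 A).
Local Notation Z := (syz A).
Local Notation inc := (kincl (aug A)).
Local Notation rel := (mklin (@middle_rel_linear R U u A)).
Local Notation mk := (coker_proj rel).

(** In [0 -> Z -> P x (U (x) Z) -> middle -> 0] the middle term is acyclic, and
    [U (x) -] sends the first map to an injective one, since the component
    [U (x) Z -> U (x) (U (x) Z)] is split by the counit. *)
Lemma acyclic_middle : acyclic i (middle u A).
Proof.
have ex : exact_seq rel mk.
  split; [|exact: coker_proj_surj|exact: coker_proj0P].
  apply: linear_inj0 => z /(congr1 fst) E; have {E} z0 : - inc z = 0 := E.
  by apply: val_inj; apply/eqP; rewrite -oppr_eq0; exact/eqP.
apply: (acyclic_quotient ip ex).
  apply: (acyclic_extension flat0 (prod_exact _ _)); first exact: (acyclic_free ip).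
  apply: (acyclic_extend epi flat0 ip aU); exact: (acyclic_syz flat1 ip).
apply: linear_inj0 => z rz; rewrite -(counit_extend_unit z).
have -> : extend_map u (extend_unit u Z) z =
    extend_map u (lin_snd P (extend u Z)) (extend_map u rel z).
  rewrite [RHS]tens_map_comp; move: z {rz}.
  by apply: tensor_ext => n m; rewrite !tens_mapE.
by rewrite [extend_map u rel z]rz !linear0.
Qed.

(** The composite [P -> middle -> U (x) P] is the unit, which [U (x) -] makes
    injective; and [U (x) P -> U (x) middle] is surjective, because the other part
    [U (x) Z] of the pushout is generated over [U] by [Z], which maps into [P]. *)
Lemma extend_map_to_extend_inj : injective (extend_map u (to_extend u A)).
Proof.
pose c := lin_comp mk (lin_inl P (extend u Z)).
have cS z : exists v, extend_map u c v = z.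
  move: z; apply: tensor_ind => [a m|_ _ [v <-] [v' <-]]; last first.
    by exists (v + v'); rewrite linearD.
  have [[x t] <-] := coker_proj_surj m.
  have [y yt] := unit_extend_surj epi (pure a t : extend u (extend u Z)).
  exists ((pure a x : extend u P) + extend_map u inc y).
  have -> : mk (x, t) = c x + from_extend u A t.
    by rewrite -(linearD mk) -[in LHS](addr0 x) -[in LHS](add0r t).
  rewrite linearD pureDr; congr (_ + _); first exact: tens_mapE.
  (* [a (x) t] is the image of [y] under [U (x) Z -> U (x) (U (x) Z)], and [Z] has
     the same images in the pushout along both of its maps. *)
  transitivity (extend_map u (from_extend u A) (pure a t : extend u (extend u Z)));
    last exact: tens_mapE.
  rewrite -yt -extend_map_unitE [LHS]tens_map_comp [RHS]tens_map_comp.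
  move: y {yt}; apply: tensor_ext => n z; rewrite !tens_mapE; congr pure.
  rewrite !lin_compE; apply/eqP; rewrite -subr_eq0 -(linearB mk).
  apply/eqP/coker_proj0P; exists (- z); apply: injective_projections.
    by rewrite /= opprK subr0.
  by rewrite /= sub0r; exact: pureNr.
apply: linear_inj0 => z; have [v <-] := cS z; move=> {z} ev.
rewrite -(counit_extend_unit v).
rewrite (_ : extend_map u (extend_unit u P) v = 0) ?linear0 // -[RHS]ev.
rewrite [RHS]tens_map_comp.
move: v {ev}; apply: tensor_ext => n x; rewrite !tens_mapE; congr pure.
by rewrite !lin_compE to_extendE linear0 addr0.
Qed.
End Middle.

(** The image of [middle -> U (x) P] is acyclic as a submodule, so
    [U (x) Gamma A] embeds into [U (x) middle]; there it lies in the kernel of the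
    injective map to [U (x) (U (x) P)]. *)
Lemma Gamma_comodule A : comodule u (Gamma u A).
Proof.
have [I [g [m [gS mI mg]]]] := image_factorization (to_extend u A).
have aI : acyclic i I.
  exact: (acyclic_sub flat1 mI (acyclic_extend_free aU (S := A))).
have ex : exact_seq (Gamma_to_middle u A) g.
  split=> // [|y]; first exact: Gamma_to_middle_inj.
  rewrite -Gamma_middle_ker -mg; split=> [->|]; first exact: linear0.
  by rewrite -(linear0 m) => /mI.
apply/(comoduleP flat0 ip); split; last first.
  apply: (acyclic_sub flat1 (@Gamma_to_middle_inj R U u A)).
  exact: acyclic_middle.
move=> x; apply: (acyclic_tens_inj flat0 ip ex aI); rewrite linear0.
apply: (@extend_map_to_extend_inj A); rewrite linear0 [LHS]tens_map_comp.
by apply: tens_map_zero => y; apply/Gamma_middle_ker; exists y.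
Qed.
End Coreflection.

(** Universality of the counit gives the adjunction: the transpose of [f] is
    the map that the counit carries to [f]. *)
Lemma Gamma_right_adjoint (R U : pzRingType) (u : {rmorphism R -> U})
    (GammaP : forall A : lmodType R, comodule u (Gamma u A)) :
  (forall (A M : lmodType R) (f : {linear M -> A}), comodule u M ->
    exists g : {linear M -> Gamma u A}, (forall m, Gamma_counit u A (g m) = f m) /\
      forall g' : {linear M -> Gamma u A},
        (forall m, Gamma_counit u A (g' m) = f m) -> g = g') ->
  is_right_adjoint (Gamma_comod GammaP) (Comod_embedding u).
Proof.
move=> univ.
pose tr (X : Comod u) (Y : lmodType R) (f : {linear sval X -> Y}) :=
  cid (univ Y (sval X) f (svalP X)).
have trE X Y f m : Gamma_counit u Y (sval (tr X Y f) m) = f m.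
  by case: (svalP (tr X Y f)) => [+ _]; apply.
have trU (X : Comod u) (Y : lmodType R) (f : {linear sval X -> Y})
    (g : {linear sval X -> Gamma u Y}) :
    (forall m, Gamma_counit u Y (g m) = f m) -> sval (tr X Y f) = g.
  by case: (svalP (tr X Y f)) => [_]; apply.
exists (fun X Y f => sval (tr X Y f)); split=> [X Y|X X' Y Y' a b f].
- exists (fun g => lin_comp (Gamma_counit u Y) g) => [f|g].
    by apply: lin_ext => m; rewrite lin_compE trE.
  exact: trU.
- apply: trU => m.
  pose a' : {linear sval X' -> sval X} := a; pose b' : {linear Y -> Y'} := b.
  have E : Gamma_counit u Y' (Gamma_map u b' (sval (tr X Y f) (a' m))) = b' (f (a' m)).
    by rewrite Gamma_counit_nat trE.
  exact: E.
Qed.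

Theorem proposition3p1 (R U : pzRingType) (u : {rmorphism R -> U})
    (u_epi : ring_epi u) (fdU : flat_dim_le1 (resr u)) :
  ([/\ closed_under_kernels (C := Mod R) (comodule u),
       closed_under_cokernels (C := Mod R) (comodule u),
       closed_under_extensions (C := Mod R) (comodule u)
     & closed_under_coproducts (C := Mod R) (comodule u)]
   /\ is_abelian (Comod u) /\ exact_functor (Comod_embedding u))
  /\
  ((forall x : Tor1 (ring_bimod u) (resl u), x = 0%R) ->
   fully_faithful (Comod_embedding u) /\
   exists GammaP : forall A : lmodType R, comodule u (Gamma u A),
     is_right_adjoint (Gamma_comod GammaP) (Comod_embedding u)).
Proof.
case: fdU => F1 [F0 [i [p [flat1 flat0 iI pS pK]]]].
have ip : exact_seq i p by [].
split; first split.
- split.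
  + exact: comodule_closed_kernels flat1 flat0 ip.
  + exact: comodule_closed_cokernels flat0 ip.
  + exact: comodule_closed_extensions flat0 ip.
  + exact: comodule_closed_coproducts flat0 ip.
- split; first exact: comodule_is_abelian flat1 flat0 ip.
  exact: comodule_embedding_exact flat1 flat0 ip.
- move=> /(acyclicP flat0 ip) aU; split; first by move=> X Y; exists id.
  exists (Gamma_comodule flat1 flat0 ip u_epi aU).
  apply: Gamma_right_adjoint => A M f; exact: (Gamma_universal flat0 ip).
Qed.
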